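(* Let $k\ge 1$ be fixed. Consider the random $k$-dimensional complex process $\{Y(n,M)\}_{0\le M\le\binom{n}{k+1}}$. Let $M_1=\min\{M: Y(n,M)\text{ has no isolated }(k-1)\text{-face}\}$ and $M_2=\min\{M: Y(n,M)\text{ is hypergraph connected}\}$. Then $\mathbb{P}(M_1=M_2)\to 1$ as $n\to\infty$; that is, with probability tending to 1, the $k$-face that eliminates the chronologically last isolated $(k-1)$-face also makes the resulting complex hypergraph connected.
   Context: $Y(n,0)$ is the complex on vertex set $[n]$ containing all subsets of $[n]$ of cardinality at most $k$ (complete $(k-1)$-skeleton) and no $k$-faces (subsets of cardinality $k+1$). For $M\ge 1$, $Y(n,M)$ is obtained from $Y(n,M-1)$ by adding a $k$-face chosen uniformly at random among the $\binom{n}{k+1}-(M-1)$ $k$-faces not yet present. A $(k-1)$-face is isolated if it is contained in no $k$-face of the complex. A $k$-dimensional complex is hypergraph connected if for every two $(k-1)$-faces $\alpha,\alpha'$ there is a sequence $\alpha=\alpha_1,\dots,\alpha_r=\alpha'$ of $(k-1)$-faces with $\alpha_i\cup\alpha_{i+1}$ a $k$-face of the complex for every $i$. *)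

(* Defs.v *)
From HB Require Import structures.
From mathcomp Require Import all_boot all_order all_algebra.
From mathcomp Require Import all_classical all_reals all_analysis.

Set Implicit Arguments.
Unset Strict Implicit.
Unset Printing Implicit Defensive.

Import Order.TTheory GRing.Theory Num.Theory.
Import numFieldNormedType.Exports.

Local Open Scope ring_scope.

(* The vertex set [n] is 'I_n, and a complex is the set of all its faces.
   Cardinality and dimension differ by one: a (k-1)-face is a face of
   cardinality k, and a k-face is one of cardinality k+1. *)
Definition faces (n c : nat) (X : {set {set 'I_n}}) : {set {set 'I_n}} :=
  [set s in X | #|s| == c].

Definition skeleton (k n : nat) : {set {set 'I_n}} :=
  [set s : {set 'I_n} | (#|s| <= k)%N].

Definition absent_faces (k n : nat) (X : {set {set 'I_n}}) : {set {set 'I_n}} :=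
  [set f : {set 'I_n} | (#|f| == k.+1) && (f \notin X)].

Definition isolated_face (k n : nat) (X : {set {set 'I_n}}) (a : {set 'I_n}) : bool :=
  (a \in faces k X) && [forall f in faces k.+1 X, ~~ (a \subset f)].

Definition no_isolated (k n : nat) (X : {set {set 'I_n}}) : bool :=
  [forall a, ~~ isolated_face k X a].

Definition face_adjacent (k n : nat) (X : {set {set 'I_n}}) : rel {set 'I_n} :=
  fun a b => [&& a \in faces k X, b \in faces k X & a :|: b \in faces k.+1 X].

(* connect e is the existence of a finite (possibly empty) e-path. *)
Definition hypergraph_connected (k n : nat) (X : {set {set 'I_n}}) : bool :=
  [forall a in faces k X, forall b in faces k X, connect (face_adjacent k X) a b].

(* A sample point: the whole sequence Y(n,0), ..., Y(n,N), N = 'C(n, k+1). *)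
Notation trajectory k n :=
  {ffun 'I_('C(n, k.+1)).+1 -> {set {set 'I_n}}}.

(* Probability of moving from X to X' when f is uniform in absent_faces k X and X'
   is X with f added. *)
Definition step_pr (R : realType) (k n : nat) (X X' : {set {set 'I_n}}) : R :=
  \sum_(f in absent_faces k X | X' == f |: X) (#|absent_faces k X|%:R)^-1.

Definition trajectory_pr (R : realType) (k n : nat) (Y : trajectory k n) : R :=
  (Y ord0 == skeleton k n)%:R *
  \prod_(M < 'C(n, k.+1)) step_pr R k (Y (inord M)) (Y (inord M.+1)).

Definition Pr (R : realType) (k n : nat) (E : pred (trajectory k n)) : R :=
  \sum_(Y : trajectory k n | E Y) trajectory_pr R Y.

(* min {M | P (Y M)}, or N + 1 if there is no such M; for n >= k+1 both hitting
   times below are almost surely at most N. *)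
Definition hitting_time (k n : nat) (P : pred {set {set 'I_n}})
    (Y : trajectory k n) : nat :=
  find (fun M : 'I_('C(n, k.+1)).+1 => P (Y M)) (enum 'I_('C(n, k.+1)).+1).

Definition M1 (k n : nat) (Y : trajectory k n) : nat :=
  hitting_time (@no_isolated k n) Y.

Definition M2 (k n : nat) (Y : trajectory k n) : nat :=
  hitting_time (@hypergraph_connected k n) Y.

(* Main.v *)
(* Fix a (k-2)-face t and look at the link graph of t: its vertices are the points
   outside t, and x, y are joined when t + x + y is a k-face.  A point x is isolated in
   the link of t iff the (k-1)-face t + x is isolated in the complex, and the complex is
   hypergraph connected as soon as, in every link, all the t + x lie in one class of the
   face adjacency relation.

   Compare the process with its state at time m = 0.95 k (ln n / n) N, N = C(n, k+1),
   slightly before the last isolated face disappears.  If the complex is disconnected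
   when its last isolated face disappears, then some link has a nonempty set S of at
   most half of its vertices, closed under adjacency.  Discard from S the points that
   are isolated at time m.  Either something is left, and at time m some link has a
   closed set without isolated points, of size at least 2 and at most half; or nothing
   is left, and after time m some face t + x + y is added while both t + x and t + y are
   isolated.  Hence the hitting times differ only if one of three things happens:
   - no face is isolated at time m: excluded by Chebyshev's inequality, the stars of two
     distinct (k-1)-faces having at most one k-face in common;
   - a closed set S without isolated points as above exists at time m: union bound, using
     for |S| <= n/20 that S must contain |S|/2 of the faces t + x + y with x, y in S;
   - two isolated faces merge after time m: union bound over t, x, y and over the time,
     the sum over times being geometric.
   For 800 k <= ln n these bounds add up to O(n^(-0.03)). *)
Require Import Defs.
From HB Require Import structures.
From mathcomp Require Import all_boot all_order all_algebra.
From mathcomp Require Import all_classical all_reals all_analysis.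
(* fintype and finset come again so that their lemmas take precedence over the
   homonyms of classical_sets *)
From mathcomp Require Import fintype finset zify ring lra.
Set Implicit Arguments.
Unset Strict Implicit.
Unset Printing Implicit Defensive.
Import Order.TTheory GRing.Theory Num.Theory.
Import numFieldNormedType.Exports.

Local Open Scope ring_scope.

(** * Finite Markov chains *)

Section MarkovPaths.
Variables (R : numDomainType) (T : finType) (K : T -> T -> R).

(** With [mu] the point mass at the skeleton and [K := step_pr] this is convertible to
    [trajectory_pr]. The initial law stays arbitrary so that an induction on the length can replace
    it by [K x]. *)
Definition path_weight (N : nat) (mu : T -> R) (Y : {ffun 'I_N.+1 -> T}) : R :=
  mu (Y ord0) * \prod_(M < N) K (Y (inord M)) (Y (inord M.+1)).

Definition push (mu : T -> R) (y : T) : R := \sum_x mu x * K x y.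

Definition ffun_cons (N : nat) (x : T) (Y : {ffun 'I_N.+1 -> T}) :
    {ffun 'I_N.+2 -> T} :=
  [ffun i => oapp Y x (unlift ord0 i)].

Lemma ffun_cons0 N x (Y : {ffun 'I_N.+1 -> T}) : ffun_cons x Y ord0 = x.
Proof. by rewrite ffunE unlift_none. Qed.

Lemma ffun_consS N x (Y : {ffun 'I_N.+1 -> T}) i :
  ffun_cons x Y (lift ord0 i) = Y i.
Proof. by rewrite ffunE liftK. Qed.

Lemma inordS N i : (i <= N)%N -> inord i.+1 = lift ord0 (inord i : 'I_N.+1) :> 'I_N.+2.
Proof. by move=> iN; apply/val_inj; rewrite /= /bump /= !inordK // ltnS. Qed.

Lemma ffun_cons_inordS N x (Y : {ffun 'I_N.+1 -> T}) i :
  (i <= N)%N -> ffun_cons x Y (inord i.+1) = Y (inord i).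
Proof. by move=> iN; rewrite inordS // ffun_consS. Qed.

Lemma inord0 N : inord 0 = ord0 :> 'I_N.+1.
Proof. by apply/val_inj; rewrite /= inordK. Qed.

Lemma sum_ffun_cons N (F : {ffun 'I_N.+2 -> T} -> R) :
  \sum_Y F Y = \sum_x \sum_(Y : {ffun 'I_N.+1 -> T}) F (ffun_cons x Y).
Proof.
rewrite pair_big (reindex (fun p => ffun_cons p.1 p.2)) //=.
exists (fun Y => (Y ord0, [ffun i => Y (lift ord0 i)])) => [[x Y] _|Y _] /=.
  by rewrite ffun_cons0; congr (_, _); apply/ffunP => i; rewrite ffunE ffun_consS.
apply/ffunP => i; rewrite ffunE; case: unliftP => [j ->|->] //=.
by rewrite ffunE.
Qed.

Lemma path_weight_cons N mu x (Y : {ffun 'I_N.+1 -> T}) :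
  path_weight mu (ffun_cons x Y) = mu x * path_weight (K x) Y.
Proof.
rewrite /path_weight ffun_cons0 big_ord_recl; congr (_ * (_ * _)).
  by rewrite inord0 ffun_cons0 ffun_cons_inordS // inord0.
apply: eq_bigr => i _; rewrite lift0.
by rewrite !ffun_cons_inordS // ltnW.
Qed.

Lemma sum_push mu (F : T -> R) :
  \sum_y push mu y * F y = \sum_x mu x * \sum_y K x y * F y.
Proof.
rewrite /push; under eq_bigr do rewrite mulr_suml.
rewrite exchange_big; apply: eq_bigr => x _; rewrite mulr_sumr.
by apply: eq_bigr => y _; rewrite mulrA.
Qed.

(** Paths are peeled from the front while [iter] adds steps at the end; averaging over the first
    state turns M steps started from [K x] into M.+1 steps started from [mu]. *)
Lemma sum_iter_push M mu (F : T -> R) :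
  \sum_x mu x * \sum_y iter M push (K x) y * F y =
  \sum_y iter M.+1 push mu y * F y.
Proof.
elim: M F => [|M IHM] F; first by rewrite /= sum_push.
rewrite [RHS]/= sum_push -IHM; apply: eq_bigr => x _; congr (_ * _).
by rewrite [LHS]/= sum_push.
Qed.

Lemma sum_path_weight N mu :
  \sum_(Y : {ffun 'I_N.+1 -> T}) path_weight mu Y = \sum_x iter N push mu x.
Proof.
elim: N mu => [|N IHN] mu.
  rewrite (reindex (fun x => [ffun=> x] : {ffun 'I_1 -> T})) /=.
    by apply: eq_bigr => x _; rewrite /path_weight big_ord0 mulr1 ffunE.
  exists (fun Y : {ffun _ -> _} => Y ord0) => [x _|Y _]; first by rewrite ffunE.
  by apply/ffunP => i; rewrite ffunE [i]ord1.
rewrite sum_ffun_cons.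
under [RHS]eq_bigr => x _ do rewrite -[iter _ _ _ _]mulr1.
rewrite -(sum_iter_push N mu (fun=> 1)); apply: eq_bigr => x _.
under eq_bigr => Y _ do rewrite path_weight_cons.
rewrite -mulr_sumr IHN; congr (_ * _).
by apply: eq_bigr => y _; rewrite mulr1.
Qed.

Hypothesis K_ge0 : forall x y, 0 <= K x y.
Hypothesis K_le1 : forall x, \sum_y K x y <= 1.

Lemma path_weight_ge0 N mu (Y : {ffun 'I_N.+1 -> T}) :
  (forall x, 0 <= mu x) -> 0 <= path_weight mu Y.
Proof. by move=> mu0; rewrite mulr_ge0 ?prodr_ge0. Qed.

(** Summing out the later states costs a factor of at most 1. Equality may fail: [step_pr] is only
    sub-Markov, with mass 0 out of a complex that has no absent face. *)
Lemma path_weight_init_le N mu (F : T -> R) :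
  (forall x, 0 <= mu x) -> (forall x, 0 <= F x) ->
  \sum_(Y : {ffun 'I_N.+1 -> T}) path_weight mu Y * F (Y ord0) <=
  \sum_x mu x * F x.
Proof.
elim: N mu F => [|N IHN] mu F mu0 F0.
  rewrite (reindex (fun x => [ffun=> x] : {ffun 'I_1 -> T})) /=.
    by apply: ler_sum => x _; rewrite /path_weight big_ord0 mulr1 ffunE.
  exists (fun Y : {ffun _ -> _} => Y ord0) => [x _|Y _]; first by rewrite ffunE.
  by apply/ffunP => i; rewrite ffunE [i]ord1.
rewrite sum_ffun_cons; apply: ler_sum => x _.
under eq_bigr => Y _ do rewrite path_weight_cons ffun_cons0 mulrAC.
rewrite -mulr_sumr -[leRHS]mulr1; apply: ler_wpM2l; first by rewrite mulr_ge0.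
have := IHN (K x) (fun=> 1) (K_ge0 x) (fun=> ler01).
under eq_bigr do rewrite mulr1.
by move=> /le_trans; apply; under eq_bigr do rewrite mulr1.
Qed.

(** The first M steps are absorbed into [iter M push mu]; the states after the observed step are
    summed out by [path_weight_init_le]. *)
Lemma path_weight_step_le N M mu (G : T -> T -> R) :
  (M < N)%N -> (forall x, 0 <= mu x) -> (forall x y, 0 <= G x y) ->
  \sum_(Y : {ffun 'I_N.+1 -> T})
     path_weight mu Y * G (Y (inord M)) (Y (inord M.+1)) <=
  \sum_x iter M push mu x * \sum_y K x y * G x y.
Proof.
elim: N M mu => [//|N IHN] [|M] mu MN mu0 G0; rewrite sum_ffun_cons.
  apply: ler_sum => x _.
  under eq_bigr => Y _ do
    rewrite path_weight_cons ffun_cons_inordS // !inord0 ffun_cons0 -mulrA.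
  by rewrite -mulr_sumr ler_wpM2l // path_weight_init_le.
have MN' : (M < N)%N by [].
rewrite -sum_iter_push; apply: ler_sum => x _.
under eq_bigr => Y _ do
  rewrite path_weight_cons (ffun_cons_inordS _ _ (ltnW MN')) ffun_cons_inordS // -mulrA.
by rewrite -mulr_sumr ler_wpM2l // IHN.
Qed.

End MarkovPaths.

(** * The one-step and one-time laws of the process *)

Definition kfaces (k n : nat) : {set {set 'I_n}} := [set f : {set 'I_n} | #|f| == k.+1].

Lemma card_kfaces k n : #|kfaces k n| = 'C(n, k.+1).
Proof. by rewrite /kfaces card_draws card_ord. Qed.

(** The possible values of the process at time M, on which its law turns out to be uniform. *)
Definition stage (k n M : nat) : {set {set {set 'I_n}}} :=
  [set X : {set {set 'I_n}} | [&& skeleton k n \subset X, X \subset skeleton k n :|: kfaces k n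
             & #|X :&: kfaces k n| == M]].

Lemma skeleton_kfacesF k n f : f \in kfaces k n -> (f \in skeleton k n) = false.
Proof. by rewrite !inE => /eqP ->; rewrite ltnn. Qed.

Lemma stage_eq k n M X : X \in stage k n M -> X = skeleton k n :|: X :&: kfaces k n.
Proof.
rewrite inE => /and3P[/subsetP sX /subsetP Xs _].
apply/setP => f; rewrite [RHS]inE [X in _ || X]inE; apply/idP/orP => [fX|[/sX//|/andP[]//]].
by have := Xs _ fX; rewrite inE => /orP[->|->]; [left | right; rewrite fX].
Qed.

Lemma setIU_kfaces k n (Z : {set {set 'I_n}}) :
  Z \subset kfaces k n -> (skeleton k n :|: Z) :&: kfaces k n = Z.
Proof.
move=> /subsetP ZK; apply/setP => f; rewrite !in_setI in_setU.
case fK: (f \in kfaces k n); last first.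
  by rewrite andbF; apply/esym/negP => /ZK; rewrite fK.
by rewrite skeleton_kfacesF // andbT.
Qed.

Lemma stageU k n (Z : {set {set 'I_n}}) :
  Z \subset kfaces k n -> skeleton k n :|: Z \in stage k n #|Z|.
Proof. by move=> ZK; rewrite inE subsetUl setUS // setIU_kfaces // eqxx. Qed.

Lemma absent_stage k n M X : X \in stage k n M ->
  absent_faces k X = kfaces k n :\: X.
Proof. by move=> _; apply/setP => f; rewrite !inE andbC. Qed.

Lemma card_absent_stage k n M X : X \in stage k n M ->
  #|absent_faces k X| = ('C(n, k.+1) - M)%N.
Proof.
move=> XM; rewrite (absent_stage XM) cardsD card_kfaces setIC.
by move: XM; rewrite inE => /and3P[_ _ /eqP ->].
Qed.

(** Keeping only the k-faces outside B is a bijection onto the subsets of size M - |B| of the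
    k-faces outside A and B; its inverse adds back B and the skeleton. *)
Lemma card_stage_avoid k n M (A B : {set {set 'I_n}}) :
  A \subset kfaces k n -> B \subset kfaces k n -> [disjoint A & B] ->
  (#|B| <= M)%N ->
  #|[set X in stage k n M | [disjoint X & A] && (B \subset X)]| =
  'C('C(n, k.+1) - #|A| - #|B|, M - #|B|).
Proof.
move=> AK BK AB BM; set E := [set X in _ | _].
have -> : ('C(n, k.+1) - #|A| - #|B|)%N = #|kfaces k n :\: (A :|: B)|.
  rewrite cardsD (setIidPr _) ?subUset ?AK // card_kfaces cardsU.
  by rewrite (eqP (_ : A :&: B == set0)) ?setI_eq0 // cards0 subn0 subnDA.
rewrite -cards_draws -(@card_in_imset _ _ (fun X => (X :&: kfaces k n) :\: B) (mem E)).
  congr #|pred_of_set _|; apply/setP => Z; rewrite inE; apply/imsetP/andP.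
    move=> [X]; rewrite inE => /and3P[XM XA BX] ->; split.
      rewrite setDUr subsetI !setSD ?subsetIr // andbT.
      apply/subsetP => f; rewrite !in_setD in_setI => /and3P[_ fX ->].
      by rewrite andbT (disjointFr XA).
    rewrite cardsD (setIidPr (_ : B \subset X :&: _)) ?subsetI ?BX //.
    by move: XM; rewrite inE => /and3P[_ _ /eqP ->].
  move=> [ZK /eqP cZ].
  have ZK' : Z \subset kfaces k n by apply: subset_trans ZK (subsetDl _ _).
  have /andP[ZA ZB] : [disjoint Z & A] && [disjoint Z & B].
    rewrite -!setI_eq0 -!subset0; apply/andP; split; apply/subsetP => f;
      rewrite inE => /andP[/(subsetP ZK)];
      by rewrite in_setD in_setU negb_or => /andP[/andP[/negPf hA /negPf hB] _]; rewrite ?hA ?hB.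
  have UK : Z :|: B \subset kfaces k n by rewrite subUset ZK'.
  exists (skeleton k n :|: (Z :|: B)).
    rewrite inE; apply/and3P; split; last by rewrite setUA subsetUr.
      have -> : M = #|Z :|: B|; last exact: stageU.
      rewrite cardsU (eqP (_ : Z :&: B == set0)) ?setI_eq0 // cards0 subn0 cZ.
      by rewrite subnK.
    rewrite -setI_eq0 !setIUl !setU_eq0 !setI_eq0 ZA (disjoint_sym B) AB !andbT.
    rewrite -setI_eq0 -subset0; apply/subsetP => f; rewrite inE => /andP[fs].
    by move=> /(subsetP AK)/skeleton_kfacesF; rewrite fs.
  rewrite setIU_kfaces // setDUl setDv setU0; apply/esym/setDidPl.
  exact: ZB.
move=> X Y; rewrite ![_ \in mem E]inE => /andP[XM /andP[_ BX]] /andP[YM /andP[_ BY]] XY.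
rewrite (stage_eq XM) (stage_eq YM); congr (_ :|: _).
rewrite -(setID (X :&: kfaces k n) B) -(setID (Y :&: kfaces k n) B) XY.
by rewrite (setIidPr (_ : B \subset X :&: _)) ?(setIidPr (_ : B \subset Y :&: _)) ?subsetI ?BX ?BY.
Qed.

Section Process.
Variables (R : realType) (k n : nat).
Let N := 'C(n, k.+1).
Notation cplx := {set {set 'I_n}}.

Definition uniform_pr (M : nat) (A : pred cplx) : R :=
  #|[set X in stage k n M | A X]|%:R / 'C(N, M)%:R.

Lemma uniform_prE M A :
  uniform_pr M A = \sum_X ((X \in stage k n M)%:R / 'C(N, M)%:R) * (A X)%:R.
Proof.
rewrite /uniform_pr -sum1_card natr_sum mulr_suml big_mkcond /=.
apply: eq_bigr => X _; rewrite [X \in _]inE.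
by case: (X \in stage k n M) => /=; case: (A X); rewrite /= ?mulr1 ?mulr0 ?mul0r.
Qed.

Lemma step_prE (X X' : cplx) : step_pr R k X X' =
  \sum_f ((f \in absent_faces k X) && (X' == f |: X))%:R / #|absent_faces k X|%:R.
Proof.
rewrite /step_pr big_mkcond; apply: eq_bigr => f _.
by case: ifP => _; rewrite ?div1r ?mul0r.
Qed.

Lemma step_pr_ge0 (X X' : cplx) : 0 <= step_pr R k X X'.
Proof. by apply: sumr_ge0 => f _; rewrite invr_ge0 ler0n. Qed.

Lemma sum_step_pr (X : cplx) (G : cplx -> R) :
  \sum_X' step_pr R k X X' * G X' =
  \sum_(f in absent_faces k X) G (f |: X) / #|absent_faces k X|%:R.
Proof.
under eq_bigr => X' _ do rewrite step_prE mulr_suml.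
rewrite exchange_big [RHS]big_mkcond; apply: eq_bigr => f _ /=.
rewrite (bigD1 (f |: X)) //= eqxx andbT big1 ?addr0 => [|X' /negPf ->].
  by case: ifP => _; rewrite ?mul0r // div1r mulrC.
by rewrite andbF !mul0r.
Qed.

Lemma sum_step_pr_le1 (X : cplx) : \sum_X' step_pr R k X X' <= 1.
Proof.
under eq_bigr do rewrite -[step_pr _ _ _ _]mulr1.
rewrite (sum_step_pr X (fun=> 1)) sumr_const div1r -[_ *+ _]mulr_natr.
have [->|h] := posnP #|absent_faces k X|; first by rewrite mulr0 ler01.
by rewrite mulVf // pnatr_eq0 -lt0n.
Qed.

(** A complex of stage M + 1 has M + 1 predecessors, one for each of its k-faces, each contributing
    1 / (C(N,M) (N - M)). Uniformity persists because (M + 1) C(N,M+1) = (N - M) C(N,M). *)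
Lemma push_stage (M : nat) (X' : cplx) : (M < N)%N ->
  push (@step_pr R k n) (fun X => (X \in stage k n M)%:R / 'C(N, M)%:R) X' =
  (X' \in stage k n M.+1)%:R / 'C(N, M.+1)%:R.
Proof.
move=> MN; rewrite /push.
have NM0 : (N - M)%:R != 0 :> R by rewrite pnatr_eq0 subn_eq0 -ltnNge.
have C0 : 'C(N, M)%:R != 0 :> R by rewrite pnatr_eq0 -lt0n bin_gt0 ltnW.
have C1 : 'C(N, M.+1)%:R != 0 :> R by rewrite pnatr_eq0 -lt0n bin_gt0.
transitivity (\sum_(f in kfaces k n) \sum_(X : cplx)
   [&& X \in stage k n M, f \notin X & X' == f |: X]%:R / ('C(N, M)%:R * (N - M)%:R) : R).
  rewrite [RHS]exchange_big; apply: eq_bigr => X _.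
  rewrite step_prE mulr_sumr [RHS]big_mkcond; apply: eq_bigr => f _.
  case XM: (X \in stage k n M); last by rewrite !mul0r /=; case: ifP; rewrite ?mul0r.
  rewrite (card_absent_stage XM) (absent_stage XM) !inE /=.
  case: (_ == k.+1); rewrite ?andbF ?mul0r ?mulr0 // andbT.
  by rewrite mulf_div mul1r.
(* For a given f the only candidate predecessor is X' without f. *)
have inner f : f \in kfaces k n -> \sum_(X : cplx)
   [&& X \in stage k n M, f \notin X & X' == f |: X]%:R / ('C(N, M)%:R * (N - M)%:R) =
   ((X' \in stage k n M.+1) && (f \in X'))%:R / ('C(N, M)%:R * (N - M)%:R) :> R.
  move=> fK; rewrite (bigD1 (X' :\ f)) //= big1 ?addr0 => [|X XX'].
    congr (_%:R / _); congr nat_of_bool; rewrite setD11 /=.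
    case fX': (f \in X'); last first.
      by rewrite andbF; apply/negP => /andP[_ /eqP/setP/(_ f)]; rewrite fX' setU11.
    rewrite setD1K // eqxx !andbT.
    have fns : f \notin skeleton k n by rewrite skeleton_kfacesF.
    rewrite !inE subsetD1 fns andbT; congr [&& _, _ & _].
      by rewrite -{2}(setD1K fX') subUset sub1set [f \in _ :|: _]inE fK orbT.
    by rewrite setIDAC (cardsD1 f (X' :&: _)) inE fX' fK add1n eqSS.
  case: and3P => [[_ fX /eqP XX]|_]; last by rewrite mul0r.
  by case/negP: XX'; rewrite XX setU1K.
rewrite (eq_bigr _ inner) -mulr_suml.
case X'M: (X' \in stage k n M.+1); last by rewrite big1 // !mul0r.
have -> : \sum_(f in kfaces k n) (true && (f \in X'))%:R = M.+1%:R :> R.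
  move: X'M; rewrite inE => /and3P[_ _ /eqP <-].
  rewrite -natr_sum -big_mkcondr -[#|_|]sum1_card; congr _%:R.
  by apply: eq_bigl => f; rewrite [in RHS]inE andbC.
have /(congr1 (fun m : nat => m%:R : R)) := mul_bin_left N M.
rewrite !natrM => e; rewrite [X in _ / X = _]mulrC -e.
by rewrite invfM mulrA divff ?pnatr_eq0.
Qed.

Lemma iter_push_stage (M : nat) (X : cplx) : (M <= N)%N ->
  iter M (push (@step_pr R k n)) (fun X => (X == skeleton k n)%:R) X =
  (X \in stage k n M)%:R / 'C(N, M)%:R.
Proof.
elim: M X => [|M IHM] X MN.
  rewrite bin0 divr1; congr (nat_of_bool _)%:R; apply/eqP/idP => [->|XM].
    by have := stageU (sub0set (kfaces k n)); rewrite setU0 cards0.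
  rewrite (stage_eq XM); move: XM; rewrite inE => /and3P[_ _].
  by rewrite cards_eq0 => /eqP ->; rewrite setU0.
rewrite /= -push_stage //; apply: eq_bigr => Z _; rewrite IHM //; exact: ltnW.
Qed.

Lemma card_stage M : #|stage k n M| = 'C(N, M).
Proof.
have := @card_stage_avoid k n M set0 set0.
rewrite !sub0set cards0 !subn0 => /(_ isT isT _ isT) <-.
  apply: eq_card => X; rewrite [RHS]inE sub0set andbT.
  by rewrite -setI_eq0 setI0 eqxx andbT.
by rewrite -setI_eq0 setI0.
Qed.

Lemma Pr_true : Pr R (fun _ : trajectory k n => true) = 1.
Proof.
rewrite /Pr (sum_path_weight (@step_pr R k n) N (fun X => (X == skeleton k n)%:R)).
under eq_bigr do rewrite iter_push_stage //.
rewrite -mulr_suml -natr_sum -big_mkcond /= sum1_card card_stage binn divr1 //.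
Qed.

Lemma trajectory_pr_ge0 (Y : trajectory k n) : 0 <= trajectory_pr R Y.
Proof.
apply: (path_weight_ge0 step_pr_ge0 Y (mu := fun X => (X == skeleton k n)%:R)) => X.
by rewrite ler0n.
Qed.

(** Whatever the state at time M, N - M faces are absent, so the prescribed f is the one added with
    probability at most 1 / (N - M). *)
Lemma Pr_step_le M (A : pred cplx) f : (M < N)%N ->
  Pr R (fun Y : trajectory k n => [&& A (Y (inord M)),
      f \in absent_faces k (Y (inord M)) & Y (inord M.+1) == f |: Y (inord M)])
  <= uniform_pr M A / (N - M)%:R.
Proof.
move=> MN.
pose G (X X' : cplx) : R := [&& A X, f \in absent_faces k X & X' == f |: X]%:R.
have H := path_weight_step_le step_pr_ge0 sum_step_pr_le1 MN
  (fun X => ler0n R (X == skeleton k n)) (fun X X' => ler0n R _ : 0 <= G X X').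
apply: (le_trans (le_trans _ H)).
  rewrite /Pr big_mkcond; apply: ler_sum => Y _; rewrite /G.
  by case: ifP => _; rewrite ?mulr1 ?mulr0.
rewrite uniform_prE mulr_suml; apply: ler_sum => X _.
rewrite iter_push_stage ?(ltnW MN) //.
case XM: (X \in stage k n M); last by rewrite !mul0r.
rewrite -[leRHS]mulrA; apply: ler_wpM2l; first by rewrite divr_ge0 ?ler0n.
rewrite sum_step_pr (card_absent_stage XM) -mulr_suml -/N.
apply: ler_wpM2r; first by rewrite invr_ge0 ler0n.
rewrite /G; case AX: (A X); last by rewrite big1.
case fX: (f \in absent_faces k X); last by rewrite big1.
rewrite (bigD1 f) //= eqxx big1 ?addr0 // => g /andP[gX gf].
case: eqP => // /setP/(_ g); rewrite !inE eqxx (negPf gf) /=.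
by move: gX; rewrite inE => /andP[_ /negPf ->].
Qed.

Lemma Pr_at_le M (A : pred cplx) : (M < N)%N ->
  Pr R (fun Y : trajectory k n => A (Y (inord M))) <= uniform_pr M A.
Proof.
move=> MN.
(* A function that ignores the arrival state turns the one-step bound into a bound at a single time;
   hence the strict M < N. *)
pose G (X X' : cplx) : R := (A X)%:R.
have H := path_weight_step_le step_pr_ge0 sum_step_pr_le1 MN
  (fun X => ler0n R (X == skeleton k n)) (fun X X' => ler0n R _ : 0 <= G X X').
apply: (le_trans (le_trans _ H)).
  rewrite /Pr big_mkcond; apply: ler_sum => Y _; rewrite /G.
  by case: ifP => _; rewrite ?mulr1 ?mulr0.
rewrite uniform_prE; apply: ler_sum => X _.
rewrite iter_push_stage ?(ltnW MN) // -mulr_suml.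
apply: ler_wpM2l; first by rewrite divr_ge0 ?ler0n.
by rewrite -[leRHS]mul1r ler_wpM2r ?ler0n ?sum_step_pr_le1.
Qed.

(** Weights vanish unless one absent face is added at each time. Through [Pr_le], deterministic
    arguments about such trajectories then bound probabilities. *)
Lemma trajectory_step (Y : trajectory k n) : trajectory_pr R Y != 0 ->
  Y ord0 = skeleton k n /\ forall M, (M < N)%N ->
  exists2 f, f \in absent_faces k (Y (inord M)) & Y (inord M.+1) = f |: Y (inord M).
Proof.
rewrite mulf_eq0 negb_or => /andP[Y0 /prodf_neq0 H]; split.
  by move: Y0; case: (Y ord0 =P skeleton k n) => // _; rewrite eqxx.
move=> M MN; have := H (Ordinal MN) isT; rewrite /= step_prE => h.
have [f /andP[fX /eqP ->]|no] := pickP (fun f =>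
  (f \in absent_faces k (Y (inord M))) && (Y (inord M.+1) == f |: Y (inord M))).
  by exists f.
by case/eqP: h; rewrite big1 // => f _; rewrite no mul0r.
Qed.

Lemma Pr_le (E E' : pred (trajectory k n)) :
  (forall Y, trajectory_pr R Y != 0 -> E Y -> E' Y) -> Pr R E <= Pr R E'.
Proof.
move=> EE'; rewrite /Pr [leLHS]big_mkcond [leRHS]big_mkcond; apply: ler_sum => Y _.
have [->|/EE' h] := eqVneq (trajectory_pr R Y) 0; first by rewrite !if_same.
by case: ifP => [/h ->|] //; case: ifP => // _ _; rewrite trajectory_pr_ge0.
Qed.

Lemma Pr_predU (E E' : pred (trajectory k n)) :
  Pr R (fun Y => E Y || E' Y) <= Pr R E + Pr R E'.
Proof.
rewrite /Pr [leLHS]big_mkcond [X in _ <= X + _]big_mkcond [X in _ <= _ + X]big_mkcond.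
rewrite -big_split; apply: ler_sum => Y _ /=; have := trajectory_pr_ge0 Y.
by case: (E Y); case: (E' Y) => /= h; rewrite ?addr0 ?add0r // lerDl.
Qed.

Lemma Pr_exists (I : finType) (P : pred I) (E : I -> pred (trajectory k n)) :
  Pr R (fun Y => [exists i, P i && E i Y]) <= \sum_(i | P i) Pr R (E i).
Proof.
rewrite /Pr (exchange_big_dep (fun=> true)) //= big_mkcond; apply: ler_sum => Y _.
case: ifP => [/existsP[i /andP[Pi Ei]]|_]; last first.
  by apply: sumr_ge0 => i _; rewrite trajectory_pr_ge0.
rewrite (bigD1 i) ?Pi //= lerDl; apply: sumr_ge0 => j _; exact: trajectory_pr_ge0.
Qed.

Lemma PrC (E : pred (trajectory k n)) : Pr R E = 1 - Pr R (fun Y => ~~ E Y).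
Proof. by rewrite -[X in X - _]Pr_true /Pr [X in _ = X - _](bigID E) /= addrK. Qed.

End Process.

(** * Disconnected trajectories *)

Section Complexes.
Variables (k n : nat).
Notation cplx := {set {set 'I_n}}.

(** For S disjoint from t: S is a union of components of the link graph of t. *)
Definition link_closed (X : cplx) (t S : {set 'I_n}) : bool :=
  [forall x in S, forall y in ~: t :\: S, (x |: (y |: t)) \notin X].

(** No point of S is isolated in the graph that the link of t induces on S. *)
Definition link_covered (X : cplx) (t S : {set 'I_n}) : bool :=
  [forall x in S, exists y in S :\ x, (x |: (y |: t)) \in X].

Lemma cardU1_out (x : 'I_n) (a : {set 'I_n}) m : #|a| = m -> x \notin a -> #|x |: a| = m.+1.
Proof. by move=> <- xa; rewrite cardsU1 xa. Qed.

Lemma stage_card_le M (X : cplx) (a : {set 'I_n}) : X \in stage k n M -> (#|a| <= k)%N -> a \in X.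
Proof. by rewrite inE => /and3P[/subsetP sX _ _] ak; apply: sX; rewrite inE. Qed.

Lemma mem_faces_k M (X : cplx) (a : {set 'I_n}) : X \in stage k n M -> (a \in faces k X) = (#|a| == k).
Proof.
move=> XM; rewrite inE andbC; case: eqP => //= ak.
by rewrite (stage_card_le XM) ?ak.
Qed.

Lemma nonisolatedP M (X : cplx) (a : {set 'I_n}) : X \in stage k n M -> #|a| = k ->
  reflect (exists2 w, w \notin a & w |: a \in X) (~~ isolated_face k X a).
Proof.
move=> XM ak; rewrite /isolated_face (mem_faces_k _ XM) ak eqxx /= negb_forall.
apply: (iffP existsP) => [[f]|[w wa waX]].
  rewrite negb_imply negbK => /andP[]; rewrite inE => /andP[fX /eqP cf] af.
  have /cards1P[w fa] : #|f :\: a| == 1%N by rewrite cardsDS // cf ak subSnn.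
  have : w \in f :\: a by rewrite fa set11.
  rewrite inE => /andP[wa _]; exists w => //.
  by rewrite -fa setDE setUIl (setUC (~: a)) setUCr setIT (setUidPl af).
exists (w |: a); rewrite negb_imply negbK subsetUr andbT inE waX.
by rewrite (cardU1_out ak wa) eqxx.
Qed.

Lemma face_adjacent_sym (X : cplx) : symmetric (face_adjacent k X).
Proof. by move=> a b; rewrite /face_adjacent setUC; case: (_ \in _) (_ \in _) => [] []. Qed.

(** This yields [M1] <= [M2]. Since 0 < k < n, exchanging a point of a for an outside point gives a
    second k-set, and any chain from a to it begins with a k-face containing a. *)
Lemma hypergraph_connected_no_isolated M (X : cplx) :
  X \in stage k n M -> (0 < k < n)%N -> hypergraph_connected k X -> no_isolated k X.
Proof.
move=> XM /andP[k0 kn] cX; apply/forallP => a; apply/negP => isoa.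
have /andP[ak _] := isoa; rewrite (mem_faces_k _ XM) in ak.
have [x xa] : exists x, x \in a by apply/card_gt0P; rewrite (eqP ak).
have [y ya] : exists y, y \in ~: a.
  by apply/card_gt0P; have := cardsC a; rewrite (eqP ak) card_ord; lia.
rewrite inE in ya; pose b := y |: (a :\ x).
have bk : #|b| = k.
  rewrite (@cardU1_out _ _ k.-1) ?prednK //; last by rewrite !inE (negPf ya) andbF.
  by rewrite (cardsD1 x) xa in ak; move/eqP: ak; lia.
have ab : a != b by apply/negP => /eqP e; rewrite e setU11 in ya.
move/forall_inP/(_ a): cX; rewrite (mem_faces_k _ XM) => /(_ ak)/forall_inP/(_ b).
rewrite (mem_faces_k _ XM) bk eqxx => /(_ isT)/connectP[[|c p] /= pth e].
  by rewrite e eqxx in ab.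
case/andP: pth => /and3P[_ _ acX] _.
case/andP: isoa => _ /forall_inP/(_ _ acX).
by rewrite subsetUl.
Qed.

(* Two k-sets are joined by a chain in which consecutive sets share k-1 points. *)
Lemma hypergraph_connected_links M (X : cplx) : X \in stage k n M -> (0 < k)%N ->
  (forall (t : {set 'I_n}) x y, #|t| = k.-1 -> x \notin t -> y \notin t ->
     connect (face_adjacent k X) (x |: t) (y |: t)) ->
  hypergraph_connected k X.
Proof.
move=> XM k0 H; apply/forall_inP => a; rewrite (mem_faces_k _ XM) => /eqP ak.
apply/forall_inP => b; rewrite (mem_faces_k _ XM) => /eqP bk.
elim: {a}_.+1 {-2}a (ltnSn #|a :\: b|) ak => // m IHm a am ak.
have [/eqP|[x]] := set_0Vmem (a :\: b).
  rewrite setD_eq0 => ab; suff -> : a = b by exact: connect0.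
  by apply/eqP; rewrite eqEcard ab ak bk leqnn.
rewrite inE => /andP[xb xa].
have [/eqP|[y]] := set_0Vmem (b :\: a).
  rewrite setD_eq0 => ba; suff e : b = a by rewrite e xa in xb.
  by apply/eqP; rewrite eqEcard ba ak bk leqnn.
rewrite inE => /andP[ya yb].
have tk : #|a :\ x| = k.-1 by rewrite -ak (cardsD1 x a) xa.
have yt : y \notin a :\ x by rewrite inE (negPf ya) andbF.
(* Exchanging x for y is a move inside the link of [a :\ x], and it removes x from [a :\: b], which
   is the induction measure. *)
apply: connect_trans (_ : connect _ a (y |: (a :\ x))) _.
  by rewrite -{1}(setD1K xa); apply: H; rewrite ?setD11.
apply: IHm; last by rewrite (cardU1_out tk) // prednK.
rewrite ltnS in am; apply: (leq_trans _ am); apply: proper_card; apply/properP; split.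
  apply/subsetP => z; rewrite !inE => /andP[zb /orP[/eqP zy|/andP[_ ->]]].
    by rewrite zy yb in zb.
  by rewrite zb.
exists x; rewrite !inE ?xa ?xb // eqxx orbF.
by apply: contraNneq xb => ->.
Qed.

End Complexes.

(** * A single trajectory and its hitting times *)

Section Trajectories.
Variables (k n : nat).
Let N := 'C(n, k.+1).
Notation cplx := {set {set 'I_n}}.
Variable Y : trajectory k n.
Notation Z M := (Y (inord M)).
Hypothesis Y0 : Y ord0 = skeleton k n.
Hypothesis YS : forall M, (M < N)%N ->
  exists2 f, f \in absent_faces k (Z M) & Z M.+1 = f |: Z M.

Lemma trajectory_stage M : (M <= N)%N -> Z M \in stage k n M.
Proof.
elim: M => [_|M IHM MN].
  have -> : inord 0 = ord0 :> 'I_N.+1 by exact: inord0.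
  by rewrite Y0; have := stageU (sub0set (kfaces k n)); rewrite setU0 cards0.
have [f fX ->] := YS MN; have XM := IHM (ltnW MN).
have fK : f \in kfaces k n by move: fX; rewrite !inE => /andP[].
have fX' : f \notin Z M by move: fX; rewrite !inE => /andP[].
move: XM; rewrite !inE => /and3P[s1 s2 /eqP c]; apply/and3P; split.
- by apply: subset_trans s1 (subsetUr _ _).
- by rewrite subUset s2 andbT sub1set inE fK orbT.
- by rewrite (_ : (f |: Z M) :&: _ = f |: (Z M :&: kfaces k n))
    ?cardsU1 ?inE ?(negPf fX') ?c // setIUl (setIidPl _) // sub1set.
Qed.

Lemma trajectory_mono M M' : (M <= M' <= N)%N -> Z M \subset Z M'.
Proof.
move=> /andP[]; elim: M' => [|M' IHM]; first by rewrite leqn0 => /eqP ->.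
rewrite leq_eqVlt => /orP[/eqP -> //|MM'] M'N.
apply: subset_trans (IHM MM' (ltnW M'N)) _.
by have [f _ ->] := YS M'N; exact: subsetUr.
Qed.

Lemma no_isolated_mono M M' : (M <= M' <= N)%N ->
  no_isolated k (Z M) -> no_isolated k (Z M').
Proof.
move=> MM'; have /andP[h h'] := MM' => /forallP nM; apply/forallP => a.
have XM := trajectory_stage (leq_trans h h'); have XM' := trajectory_stage h'.
have [ak|ak] := eqVneq #|a| k; last first.
  by rewrite /isolated_face (mem_faces_k _ XM') (negPf ak).
have /(nonisolatedP XM ak)[w wa wX] := nM a.
by apply/(nonisolatedP XM' ak); exists w => //; apply: (subsetP (trajectory_mono MM')).
Qed.

Lemma trajectory_final : kfaces k n \subset Z N.
Proof.
have := trajectory_stage (leqnn N); rewrite inE => /and3P[_ _ /eqP c].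
by apply/setIidPr/eqP; rewrite eqEcard subsetIr c card_kfaces leqnn.
Qed.

Lemma hitting_timeE (P : pred cplx) m : (m <= N)%N -> P (Z m) ->
  (forall i, (i < m)%N -> ~~ P (Z i)) -> hitting_time P Y = m.
Proof.
move=> mN Pm Pi; rewrite /hitting_time.
have -> : find (fun M : 'I_N.+1 => P (Y M)) (enum 'I_N.+1) =
          find (fun i => P (Z i)) (iota 0 N.+1).
  rewrite -val_enum_ord find_map; apply: eq_find => i /=; by rewrite inord_val.
have -> : iota 0 N.+1 = iota 0 m ++ m :: iota m.+1 (N - m).
  by rewrite -[in LHS](subnKC (leqW mN)) subSn // iotaD.
rewrite find_cat.
rewrite (_ : has _ _ = false) /= ?add0n ?Pm ?size_iota ?addn0 //.
by apply/hasP => [[i]]; rewrite mem_iota add0n /= => /Pi/negPf ->.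
Qed.

Lemma hitting_times_neq M0 : (0 < k < n)%N -> (M0 <= N)%N -> M1 Y != M2 Y ->
  [\/ no_isolated k (Z M0),
      exists (t S : {set 'I_n}), [/\ #|t| = k.-1, S \subset ~: t, (1 < #|S|)%N,
        (2 * #|S| <= #|~: t|)%N & link_closed (Z M0) t S && link_covered (Z M0) t S] |
      exists (t : {set 'I_n}) z w M, [/\ #|t| = k.-1, (z \notin t) && (w \notin z |: t),
        (M0 <= M < N)%N,
        isolated_face k (Z M) (z |: t) && isolated_face k (Z M) (w |: t) &
        (w |: (z |: t) \in absent_faces k (Z M)) &&
        (Z M.+1 == (w |: (z |: t)) |: Z M)]].
Proof.
move=> /[dup] kn /andP[k0 kln] M0N M12.
have nisoN : no_isolated k (Z N).
  apply/forallP => a; have XN := trajectory_stage (leqnn N).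
  have [ak|ak] := eqVneq #|a| k; last by rewrite /isolated_face (mem_faces_k _ XN) (negPf ak).
  have [w wa] : exists y, y \in ~: a.
    by apply/card_gt0P; have := cardsC a; rewrite ak card_ord; lia.
  rewrite inE in wa; apply/(nonisolatedP XN ak); exists w => //.
  by apply: (subsetP trajectory_final); rewrite inE (cardU1_out ak).
have exm : exists m, (m <= N)%N && no_isolated k (Z m) by exists N; rewrite leqnn.
(* [m] is the value of [M1]. Were [Z m] connected, [M2] would be m as well: every earlier complex
   has an isolated face, hence is disconnected. *)
case: (ex_minnP exm) => m /andP[mN nisom] mmin.
have Xm := trajectory_stage mN.
have mmin' i : (i < m)%N -> ~~ no_isolated k (Z i).
  move=> im; apply/negP => ni; have := mmin i; rewrite ni (leq_trans (ltnW im) mN).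
  by move=> /(_ isT); rewrite leqNgt im.
have hm : ~~ hypergraph_connected k (Z m).
  apply: contraNN M12 => hm.
  rewrite /M1 /M2 (hitting_timeE mN nisom mmin') (hitting_timeE mN hm) // => i im.
  apply: contraNN (mmin' _ im) => hi.
  exact: (hypergraph_connected_no_isolated (trajectory_stage (leq_trans (ltnW im) mN))).
have [|niso0] := boolP (no_isolated k (Z M0)); first by move=> ?; constructor 1.
have M0m : (M0 < m)%N.
  rewrite ltnNge; apply: contraNN niso0 => mM0.
  by apply: no_isolated_mono nisom; rewrite mM0.
have M0mN : (M0 <= m <= N)%N by rewrite ltnW.
have YM0m := subsetP (trajectory_mono M0mN).
have X0 := trajectory_stage M0N.
pose r := connect (face_adjacent k (Z m)).
have rsym : connect_sym (face_adjacent k (Z m)).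
  exact: (sym_connect_sym (@face_adjacent_sym k n _)).
have [t [x [y [tk xt yt nr]]]] : exists (t : {set 'I_n}) x y,
    [/\ #|t| = k.-1, x \notin t, y \notin t & ~~ r (x |: t) (y |: t)].
  apply: contrapT => no; move/negP: hm; apply.
  apply: (hypergraph_connected_links Xm k0) => t x y tk xt yt.
  by apply/negPn/negP => h; apply: no; exists t, x, y.
have tU z : z \notin t -> #|z |: t| = k by move=> zt; rewrite (cardU1_out tk) // prednK.
have [S [St S0 Scard Scl]] : exists S : {set 'I_n}, [/\ S \subset ~: t, S != finset.set0,
   (2 * #|S| <= #|~: t|)%N & forall z w, z \in S -> w \notin t ->
     w \notin z |: t -> w |: (z |: t) \in Z m -> w \in S].
  (* The points z for which t + z is in the class of t + x, in the whole complex at time m. This set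
     and its complement outside t are both closed and nonempty (they contain x and y), and one of
     them has at most half of the points. *)
  pose S := [set z in ~: t | r (x |: t) (z |: t)].
  have adj z w : z \notin t -> w \notin t -> w \notin z |: t ->
      w |: (z |: t) \in Z m -> r (x |: t) (z |: t) = r (x |: t) (w |: t).
    move=> zt wt wzt wX; apply: same_connect_r => //; apply: connect1.
    rewrite /face_adjacent !(mem_faces_k _ Xm) !tU // eqxx /= inE.
    rewrite setUACA setUid (setUC [set z]) -setUA wX.
    by rewrite (cardU1_out (tU z zt)) // eqxx.
  have St : S \subset ~: t by apply/subsetP => z; rewrite inE => /andP[].
  have [h|h] := leqP (2 * #|S|) #|~: t|.
    exists S; split => // [|z w].
      by apply/set0Pn; exists x; rewrite !inE xt /r connect0.
    rewrite !inE => /andP[zt rz] wt wz wX; rewrite wt /=.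
    by rewrite -(adj z w) // !inE.
  exists (~: t :\: S); split; rewrite ?subsetDl //.
  - by apply/set0Pn; exists y; rewrite !inE yt (negPf nr).
  - by rewrite cardsDS //; lia.
  move=> z w; rewrite !inE => /andP[/nandP[h1 zt|rz zt] wt wz wX]; first by rewrite zt in h1.
  rewrite wt andbT /=.
  by rewrite -(adj z w) // !inE.
have wS z w : z \in S -> w \notin z |: t -> w |: (z |: t) \in Z m -> w \in S.
  by move=> zS wz; apply: (Scl z) => //; apply: contraNN wz => wt; rewrite inE wt orbT.
have St' z : z \in S -> z \notin t by move=> /(subsetP St); rewrite inE.
have nb z : z \in S -> exists2 w, w \notin z |: t & w |: (z |: t) \in Z m.
  by move=> zS; apply/(nonisolatedP Xm) => //; [apply: tU; exact: St' | exact: (forallP nisom)].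
have symU (z w : 'I_n) : w |: (z |: t) = z |: (w |: t) by rewrite !setUA (setUC [set w]).
have wzsym z w : z \notin t -> w \notin z |: t -> z \notin w |: t.
  by move=> zt; rewrite !inE !negb_or eq_sym zt => /andP[->].
(* At time M0, any neighbour of a point of S lies in S, by closedness at time m, and is itself not
   isolated. So S' is closed and covered at time M0, and has two points once it is nonempty. *)
pose S' := [set z in S | ~~ isolated_face k (Z M0) (z |: t)].
have S'S : S' \subset S by apply/subsetP => z; rewrite inE => /andP[].
have nbS' z w : z \in S -> w \notin z |: t -> w |: (z |: t) \in Z M0 -> w \in S'.
  move=> zS wz wX; have wS1 : w \in S by apply: (wS z) => //; exact: YM0m.
  rewrite inE wS1; apply/(nonisolatedP X0); first by apply: tU; exact: St'.
  by exists z; [apply: wzsym => //; exact: St' | rewrite -symU].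
have [S'0|[z zS']] := set_0Vmem S'; last first.
  constructor 2; exists t, S'.
  have nbz z' : z' \in S' -> exists w, [/\ w \in S', w \notin z' |: t & w |: (z' |: t) \in Z M0].
    rewrite inE => /andP[z'S /(nonisolatedP X0 (tU _ (St' _ z'S)))[w wz wX]].
    by exists w; split => //; apply: nbS' wX.
  split => //.
  - exact: subset_trans S'S St.
  - have [w [wS' wz _]] := nbz z zS'.
    apply: (@leq_trans #|[set z; w]|); last by apply: subset_leq_card; rewrite subUset !sub1set zS'.
    by rewrite cards2; move: wz; rewrite !inE negb_or eq_sym => /andP[->].
  - apply: leq_trans Scard; rewrite leq_mul2l /=; exact: subset_leq_card.
  apply/andP; split.
    apply/forall_inP => z' z'S'; apply/forall_inP => w; rewrite !inE => /andP[wS' wt].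
    have z'S := subsetP S'S _ z'S'.
    have wz' : w != z' by apply: contraNneq wS' => ->; move: z'S'; rewrite inE.
    apply: contraNN wS' => wX; rewrite -symU in wX.
    have wz : w \notin z' |: t.
      by rewrite !inE negb_or wt wz'.
    by have := nbS' z' w z'S wz wX; rewrite inE.
  apply/forall_inP => z' z'S'; have [w [wS' wz wX]] := nbz z' z'S'.
  apply/exists_inP; exists w; last by rewrite -symU.
  by rewrite in_setD1 wS' andbT; move: wz; rewrite !inE negb_or => /andP[].
constructor 3.
(* Now all of S is isolated at time M0. At the first time some z of S stops being isolated, the new
   face is t + z + w with w in S by closedness, and just before it both t + z and t + w were
   isolated. *)
pose Q M := (M0 <= M <= m)%N && [exists z in S, ~~ isolated_face k (Z M) (z |: t)].
have [z0 z0S] : exists z, z \in S by apply/set0Pn.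
have exQ : exists M, Q M.
  exists m; rewrite /Q leqnn ltnW //=; apply/exists_inP; exists z0 => //.
  exact: (forallP nisom).
case: (ex_minnP exQ) => M' /andP[/andP[M0M' M'm] /exists_inP[z zS zni]] M'min.
have iso0 z' : z' \in S -> isolated_face k (Z M0) (z' |: t).
  by move=> z'S; apply/negPn/negP => h; have := in_set0 z'; rewrite -S'0 inE z'S h.
have M0ltM' : (M0 < M')%N.
  by rewrite ltn_neqAle M0M' andbT; apply: contraNneq zni => <-; exact: iso0.
case: M' M0M' M'm zni M'min M0ltM' => // M _ Mm zni Mmin M0M.
have MN : (M < N)%N by apply: leq_trans mN.
have isoM z' : z' \in S -> isolated_face k (Z M) (z' |: t).
  move=> z'S; apply/negPn/negP => h; suff : (M < M)%N by rewrite ltnn.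
  apply: Mmin; by rewrite /Q -ltnS M0M (ltnW Mm); apply/exists_inP; exists z'.
have XM := trajectory_stage (ltnW MN); have XM1 := trajectory_stage MN.
have [f fabs YM] := YS MN.
have zt := St' _ zS.
have /(nonisolatedP XM1 (tU z zt))[w wz wX] := zni.
have wXM : w |: (z |: t) \notin Z M.
  apply/negP => h; have := isoM z zS; apply/negP.
  by apply/(nonisolatedP XM (tU z zt)); exists w.
have ef : w |: (z |: t) = f by move: wX; rewrite YM !inE -!/(_ \in _) (negPf wXM) orbF => /eqP.
have wSS : w \in S.
  apply: (wS z) => //; apply: (subsetP (trajectory_mono _) _ wX).
  by rewrite Mm.
exists t, z, w, M; split => //.
- by rewrite zt.
- by rewrite -ltnS M0M.
- by rewrite !isoM.
- by rewrite ef fabs YM eqxx.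
Qed.

End Trajectories.

(** * Ratios of binomial coefficients *)

Section Binomials.
Local Open Scope nat_scope.

(** Read as (x - m) / x <= (y - m) / y, it compares the factors of the binomial ratios below one at
    a time. *)
Lemma leq_mul_sub x y m : x <= y -> y * (x - m) <= x * (y - m).
Proof. by move=> xy; rewrite !mulnBr mulnC leq_sub2l // leq_mul2r xy orbT. Qed.

(** The ratio C(N-a,M) / C(N,M) is the product over i < a of (N - i - M) / (N - i), and each factor
    is at most (N - M) / N. *)
Lemma bin_sub_le N a M : a <= N -> M <= N ->
  'C(N - a, M) * N ^ a <= 'C(N, M) * (N - M) ^ a.
Proof.
move=> + MN; elim: a => [|a IHa] aN; first by rewrite subn0.
have h := mul_bin_down (N - a) M; rewrite -subnS in h.
have step : 'C(N - a.+1, M) * N <= 'C(N - a, M) * (N - M).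
  rewrite -(leq_pmul2l (m := N - a)) ?subn_gt0 // mulnA h mulnAC [leqRHS]mulnCA [leqRHS]mulnC.
  by rewrite leq_mul2r [_ * N]mulnC leq_mul_sub ?leq_subr ?orbT.
rewrite !expnS mulnA; apply: leq_trans (leq_mul step (leqnn _)) _.
by rewrite mulnAC [leqRHS]mulnCA mulnC leq_mul2l IHa ?orbT // ltnW.
Qed.

(** In the same product each factor is at least (N - a - M) / (N - a). *)
Lemma bin_sub_ge N a M : M + a <= N ->
  'C(N, M) * (N - a - M) ^ a <= 'C(N - a, M) * (N - a) ^ a.
Proof.
move=> MaN.
suff H i : i <= a -> 'C(N, M) * (N - a - M) ^ i <= 'C(N - i, M) * (N - a) ^ i by exact: H.
elim: i => [|i IHi] ia; first by rewrite subn0.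
have h := mul_bin_down (N - i) M; rewrite -subnS in h.
have step : 'C(N - i, M) * (N - a - M) <= 'C(N - i.+1, M) * (N - a).
  rewrite -(leq_pmul2l (m := N - i)) ?subn_gt0; last first.
    by apply: leq_trans ia (leq_trans (leq_addl _ _) MaN).
  rewrite [leqRHS]mulnA h [leqLHS]mulnA [leqLHS]mulnAC [leqRHS]mulnAC leq_mul2r.
  by rewrite [(N - i - M) * _]mulnC leq_mul_sub ?orbT // leq_sub2l // ltnW.
rewrite !expnS [leqLHS]mulnCA [leqRHS]mulnA.
apply: leq_trans (leq_mul step (leqnn _)).
by rewrite [leqRHS]mulnAC mulnC leq_mul2r IHi ?orbT // ltnW.
Qed.

(** Here the factors are (m - i) / (n - i) for i < b, each at most m / n. *)
Lemma bin_sub_both_le n m b : b <= m -> m <= n ->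
  'C(n - b, m - b) * n ^ b <= 'C(n, m) * m ^ b.
Proof.
move=> + mn; elim: b => [|b IHb] bm; first by rewrite !subn0.
have h := mul_bin_diag (n - b) (m - b).-1.
rewrite prednK ?subn_gt0 // -!subnS in h.
have step : 'C(n - b.+1, m - b.+1) * n <= 'C(n - b, m - b) * m.
  rewrite -(leq_pmul2l (m := n - b)) ?subn_gt0; last exact: leq_trans mn.
  rewrite mulnA h [leqLHS]mulnAC [leqRHS]mulnCA [leqRHS]mulnC leq_mul2r.
  by rewrite mulnC [_ * m]mulnC leq_mul_sub ?orbT.
rewrite !expnS !mulnA; apply: leq_trans (leq_mul step (leqnn _)) _.
by rewrite mulnAC [leqRHS]mulnAC leq_mul2r IHb ?orbT // ltnW.
Qed.

(** Removing j elements shrinks the binomial by a larger proportion when the ground set is smaller.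
    In the second moment this makes two isolated faces nearly independent. *)
Lemma bin_sub_cross_le N N' M j : N' <= N -> M <= N ->
  'C(N' - j, M) * 'C(N, M) <= 'C(N - j, M) * 'C(N', M).
Proof.
move=> NN MN; elim: j => [|j IHj]; first by rewrite !subn0 mulnC.
have [jN'|N'j] := ltnP j N'; last first.
  have -> : N' - j.+1 = N' - j by rewrite subnS; move: N'j; rewrite -subn_eq0 => /eqP ->.
  have [->|M0] := posnP M; first by rewrite !bin0.
  by move: N'j; rewrite -subn_eq0 => /eqP ->; rewrite bin_small.
have h := mul_bin_down (N - j) M; have h' := mul_bin_down (N' - j) M.
rewrite -!subnS in h h'.
have jN : j < N := leq_trans jN' NN.
rewrite -(leq_pmul2l (m := (N - j) * (N' - j))) ?muln_gt0 ?subn_gt0 ?jN //.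
rewrite (_ : (N - j) * (N' - j) * _ = (N - j) * (N' - j - M) * ('C(N' - j, M) * 'C(N, M))); last first.
  by rewrite -[LHS]mulnA [(N' - j) * _]mulnA h' !mulnA.
rewrite (_ : (N - j) * (N' - j) * ('C(N - j.+1, M) * _) =
  (N' - j) * (N - j - M) * ('C(N - j, M) * 'C(N', M))); last first.
  by rewrite [LHS]mulnA [_ * (N' - j)]mulnC -[X in X * _]mulnA h !mulnA.
by rewrite leq_mul // leq_mul_sub // leq_sub2r.
Qed.

Lemma bin_le_exp2 n m : 'C(n, m) <= 2 ^ n.
Proof.
rewrite -[n in 'C(n, _)]card_ord -card_draws -[n in 2 ^ n]card_ord -cardsT -card_powerset.
by apply: subset_leq_card; apply/subsetP => A _; rewrite inE subsetT.
Qed.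

Lemma bin_fact_le n m : 'C(n, m) * m`! <= n ^ m.
Proof.
rewrite bin_ffact ffact_prod; apply: leq_trans (_ : \prod_(i < m) n <= _).
  by apply: leq_prod => i _; exact: leq_subr.
by rewrite prod_nat_const card_ord.
Qed.

Lemma bin_le_exp n m : 'C(n, m) <= n ^ m.
Proof. by apply: leq_trans (bin_fact_le n m); rewrite leq_pmulr ?fact_gt0. Qed.

(** s^s <= (s+1)...(2s) = C(2s,s) s! <= 4^s s!, while C(n,s) s! <= n^s. *)
Lemma bin_mul_exp_le n s : 'C(n, s) * s ^ s <= (4 * n) ^ s.
Proof.
have h : s ^ s <= 2 ^ (s + s) * s`!.
  apply: leq_trans (_ : 'C(s + s, s) * s`! <= _); last by rewrite leq_mul2r bin_le_exp2 orbT.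
  rewrite bin_ffact ffact_prod; apply: leq_trans (_ : \prod_(i < s) s <= _).
    by rewrite prod_nat_const card_ord.
  by apply: leq_prod => i _; rewrite -addnBA ?leq_addr // ltnW.
apply: leq_trans (leq_mul (leqnn _) h) _.
rewrite mulnCA expnMn addnn -mul2n expnM leq_mul2l bin_fact_le orbT //.
Qed.

Lemma exp_le_bin n k : k <= n -> n ^ k <= k ^ k * 'C(n, k).
Proof.
move=> kn; rewrite -(leq_pmul2r (fact_gt0 k)) -mulnA bin_ffact.
rewrite -(ffactnn k) !ffact_prod.
have e m : m ^ k = \prod_(i < k) m by rewrite prod_nat_const card_ord.
rewrite !e -!big_split /=; apply: leq_prod => i _.
by rewrite leq_mul_sub.
Qed.

(** Binomials increase up to the middle; j = k + 1 gives a quadratic lower bound on the number of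
    k-faces. *)
Lemma bin_gt2_ge n j : 1 < j -> j.*2 <= n.+1 -> 'C(n, 2) <= 'C(n, j).
Proof.
elim: j => // j IHj; rewrite ltnS leq_eqVlt => /orP[/eqP <- //|j1] jn.
apply: leq_trans (IHj j1 _) _; first by apply: leq_trans jn; rewrite leq_double.
rewrite -(leq_pmul2l (ltn0Sn j)) mul_bin_left leq_mul2r.
by apply/orP; right; rewrite -addnn in jn; lia.
Qed.

End Binomials.

(** * The same ratios as real bounds *)

Section RealBounds.
Variable R : realType.

Lemma bin_ratio_le N a M : (0 < N)%N -> (a <= N)%N -> (M <= N)%N ->
  'C(N - a, M)%:R / 'C(N, M)%:R <= (1 - M%:R / N%:R) ^+ a :> R.
Proof.
move=> N0 aN MN; have C0 : 0 < 'C(N, M)%:R :> R by rewrite ltr0n bin_gt0.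
have N0' : 0 < N%:R :> R by rewrite ltr0n.
rewrite ler_pdivrMr // (_ : 1 - M%:R / N%:R = (N - M)%:R / N%:R :> R); last first.
  by rewrite natrB // mulrBl divff ?gt_eqF.
rewrite expr_div_n mulrAC ler_pdivlMr ?exprn_gt0 // [leRHS]mulrC.
by rewrite -!natrX -!natrM ler_nat bin_sub_le.
Qed.

Lemma bin_ratio_ge N a M : (0 < N - a)%N -> (M + a <= N)%N ->
  (1 - M%:R / (N - a)%:R) ^+ a <= 'C(N - a, M)%:R / 'C(N, M)%:R :> R.
Proof.
move=> N0 aN; have C0 : 0 < 'C(N, M)%:R :> R.
  by rewrite ltr0n bin_gt0 (leq_trans (leq_addr _ _) aN).
have N0' : 0 < (N - a)%:R :> R by rewrite ltr0n.
rewrite ler_pdivlMr // (_ : 1 - M%:R / (N - a)%:R = (N - a - M)%:R / (N - a)%:R :> R); last first.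
  have MNa : (M <= N - a)%N by rewrite leq_subRL 1?addnC // (leq_trans (leq_addl _ _) aN).
  by rewrite (natrB _ MNa) mulrBl divff ?gt_eqF.
rewrite expr_div_n mulrAC ler_pdivrMr ?exprn_gt0 // [leLHS]mulrC.
by rewrite -!natrX -!natrM ler_nat bin_sub_ge.
Qed.

(** The ratio splits into avoiding a elements, then containing b of the remaining N - a. The factor
    [(b <= M)] gives 0 where the truncated M - b would make the binomial equal to 1. *)
Lemma bin_both_ratio_le N a b M : (a + M <= N)%N -> (0 < N - a)%N ->
  'C(N - a - b, M - b)%:R * (b <= M)%N%:R / 'C(N, M)%:R <=
  (1 - M%:R / N%:R) ^+ a * (M%:R / (N - a)%:R) ^+ b :> R.
Proof.
move=> aMN Na0; have aN : (a <= N)%N by apply: leq_trans aMN; exact: leq_addr.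
have N0 : (0 < N)%N by apply: leq_trans Na0 (leq_subr _ _).
have MN : (M <= N)%N by apply: leq_trans aMN; exact: leq_addl.
have x0 : 0 <= 1 - M%:R / N%:R :> R.
  by rewrite subr_ge0 ler_pdivrMr ?ltr0n // mul1r ler_nat.
case: (leqP b M) => bM; last by rewrite mulr0 mul0r mulr_ge0 ?exprn_ge0 ?divr_ge0.
have C1 : 0 < 'C(N - a, M)%:R :> R by rewrite ltr0n bin_gt0 leq_subRL.
rewrite mulr1 (_ : _ / _ = 'C(N - a, M)%:R / 'C(N, M)%:R *
  ('C(N - a - b, M - b)%:R / 'C(N - a, M)%:R)); last first.
  by rewrite [RHS]mulrC mulrA divfK ?gt_eqF.
apply: ler_pM; rewrite ?divr_ge0 ?ler0n ?bin_ratio_le //.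
rewrite expr_div_n ler_pdivrMr // mulrAC ler_pdivlMr ?exprn_gt0 ?ltr0n // [leRHS]mulrC.
by rewrite -!natrX -!natrM ler_nat bin_sub_both_le // leq_subRL.
Qed.
End RealBounds.

(** * Faces avoided and contained by a uniform complex *)

Section Stars.
Variables (k n : nat).
Notation cplx := {set {set 'I_n}}.

Definition star (a : {set 'I_n}) : {set {set 'I_n}} := [set f in kfaces k n | a \subset f].

Lemma star_sub a : star a \subset kfaces k n.
Proof. by apply/subsetP => f; rewrite inE => /andP[]. Qed.

Lemma isolated_disjoint M (X : cplx) (a : {set 'I_n}) : X \in stage k n M -> #|a| = k ->
  isolated_face k X a = [disjoint X & star a].
Proof.
move=> XM ak; rewrite /isolated_face (mem_faces_k _ XM) ak eqxx /=.
rewrite -setI_eq0; apply/forall_inP/eqP => [H|H f].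
  apply/setP => f; rewrite !inE; apply/negP => /and3P[fX fk].
  by apply/negP; apply: H; rewrite inE fX.
rewrite inE => /andP[fX fk]; apply/negP => af.
by have := in_set0 f; rewrite -H !inE fX fk af.
Qed.

Lemma starE (a : {set 'I_n}) : #|a| = k -> star a = [set w |: a | w in ~: a].
Proof.
move=> ak; apply/setP => f; rewrite !inE; apply/andP/imsetP => [[fk af]|[w]].
  have /cards1P[w fa] : #|f :\: a| == 1%N by rewrite cardsDS // (eqP fk) ak subSnn.
  have : w \in f :\: a by rewrite fa set11.
  rewrite inE => /andP[wa wf]; exists w; rewrite ?inE //.
  by rewrite -fa setDE setUIl (setUC (~: a)) setUCr setIT (setUidPl af).
by rewrite inE => wa ->; rewrite (cardU1_out ak) // eqxx subsetUr.
Qed.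

Lemma card_star (a : {set 'I_n}) : #|a| = k -> #|star a| = (n - k)%N.
Proof.
move=> ak; rewrite starE // card_in_imset => [|x y].
  by have := cardsC a; rewrite ak card_ord; lia.
rewrite !inE => xa ya /setP/(_ x); rewrite !inE eqxx (negPf xa) /= orbF.
by move/esym/eqP => ->.
Qed.

(** Each star has n - k faces, and [a :|: b] is the only k-face that can lie in both. *)
Lemma card_starU (a b : {set 'I_n}) : #|a| = k -> #|b| = k -> a != b ->
  (2 * (n - k) - 1 <= #|star a :|: star b|)%N.
Proof.
move=> ak bk ab; rewrite cardsU !card_star // mul2n addnn leq_sub2l //.
apply: leq_trans (_ : #|[set a :|: b]| <= _)%N; last by rewrite cards1.
apply: subset_leq_card; apply/subsetP => f; rewrite !inE.
move=> /andP[/andP[/eqP fk af] /andP[_ bf]]; rewrite eq_sym eqEcard subUset af bf fk /=.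
rewrite ltnNge; apply: contraNN ab => abk.
have ea : a = a :|: b by apply/eqP; rewrite eqEcard subsetUl ak.
have eb : b = a :|: b by apply/eqP; rewrite eqEcard subsetUr bk.
by rewrite {1}ea -eb.
Qed.

End Stars.

(** * Faces crossing or inside a set of link vertices *)

Section Links.
Variables (k n : nat) (t S : {set 'I_n}).
Hypotheses (k0 : (0 < k)%N) (tk : #|t| = k.-1) (St : S \subset ~: t).
Notation cplx := {set {set 'I_n}}.

(** As k-faces, the edges of the link graph of t that leave S; a closed S forbids all of them. *)
Definition cross : cplx := [set x |: (y |: t) | x in S, y in ~: t :\: S].
Definition inner : cplx := [set x |: (y |: t) | x in S, y in S :\ x].

Lemma kfaces_link (x y : 'I_n) : x \notin t -> y \notin t -> x != y ->
  x |: (y |: t) \in kfaces k n.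
Proof.
move=> xt yt xy; rewrite inE (@cardU1_out _ _ _ k) ?(cardU1_out tk) ?prednK //.
by rewrite !inE negb_or xy.
Qed.

Lemma link_notin x : x \in S -> x \notin t.
Proof. by move/(subsetP St); rewrite inE. Qed.

Lemma cross_sub : cross \subset kfaces k n.
Proof.
apply/subsetP => _ /imset2P[x y xS + ->]; rewrite !inE => /andP[yS yt].
by have := kfaces_link (link_notin xS) yt; rewrite inE; apply; apply: contraNneq yS => <-.
Qed.

Lemma inner_sub : inner \subset kfaces k n.
Proof.
apply/subsetP => _ /imset2P[x y xS + ->]; rewrite in_setD1 => /andP[yx yS].
by apply: kfaces_link; rewrite ?link_notin // eq_sym.
Qed.

(** Removing t recovers the edge from its k-face; the count of [cross] and its disjointness from
    [inner] rest on this. *)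
Lemma link_trace (x y : 'I_n) : x \notin t -> y \notin t -> (x |: (y |: t)) :\: t = [set x; y].
Proof.
move=> xt yt; apply/setP => z; rewrite !inE.
have [->|zx] := eqVneq z x; first by rewrite xt.
have [->|zy] := eqVneq z y; first by rewrite yt.
by rewrite /= andNb.
Qed.

Lemma card_cross : #|cross| = (#|S| * (#|~: t| - #|S|))%N.
Proof.
rewrite -cardsDS // /cross curry_imset2X card_in_imset ?cardsX //.
move=> [x y] [x' y']; rewrite !inE /= => /and3P[xS yS yt] /and3P[xS' yS' yt'] e.
have := congr1 (fun f => f :\: t) e.
rewrite (link_trace (link_notin xS) yt) (link_trace (link_notin xS') yt') => e2.
have : x \in [set x'; y'] by rewrite -e2 set21.
rewrite !inE => /orP[/eqP ex|/eqP ex]; last by rewrite -ex xS in yS'.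
have : y \in [set x'; y'] by rewrite -e2 set22.
rewrite !inE => /orP[/eqP ey|/eqP ey]; last by rewrite ex ey.
by rewrite ey xS' in yS.
Qed.

Lemma disjoint_cross_inner : [disjoint cross & inner].
Proof.
rewrite -setI_eq0 -subset0; apply/subsetP => f; rewrite inE => /andP[].
move=> /imset2P[x y xS + ->] /imset2P[x' y' xS' + e]; rewrite !inE => /andP[yS yt] /andP[_ yS'].
have := congr1 (fun f => f :\: t) e; rewrite (link_trace (link_notin xS) yt) (link_trace (link_notin xS') (link_notin yS')) => e2.
have : y \in [set x'; y'] by rewrite -e2 set22.
by rewrite !inE => /orP[] /eqP ey; rewrite ey ?xS' ?yS' in yS.
Qed.

Lemma card_inner : (#|inner| <= #|S| * #|S|)%N.
Proof.
rewrite -cardsX; apply: leq_trans (leq_imset_card (fun p => p.1 |: (p.2 |: t)) _).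
apply: subset_leq_card; apply/subsetP => _ /imset2P[x y xS + ->].
rewrite in_setD1 => /andP[_ yS]; apply/imsetP; exists (x, y) => //.
by rewrite inE /= xS.
Qed.

Lemma link_closed_disjoint (X : cplx) : link_closed X t S -> [disjoint X & cross].
Proof.
move=> H; rewrite -setI_eq0 -subset0; apply/subsetP => f; rewrite inE => /andP[fX].
move=> /imset2P[x y xS yS ef]; move/forall_inP/(_ x xS)/forall_inP/(_ y yS): H.
by rewrite -ef fX.
Qed.

(* Every inner face meets S in two points, so covering S takes |S|/2 of them. *)
Lemma link_covered_inner (X : cplx) : link_covered X t S ->
  exists2 B, B \in [set B : cplx | B \subset inner & #|B| == #|S|./2] & B \subset X.
Proof.
move=> /forall_inP H.
have c2 : (#|S| <= 2 * #|X :&: inner|)%N.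
  apply: leq_trans (_ : \sum_(f in X :&: inner) #|S :&: (f :\: t)| <= _)%N.
    have cE (f : {set 'I_n}) : #|S :&: (f :\: t)| = (\sum_(x in S) (x \in f :\: t))%N.
      rewrite -sum1_card (eq_bigl (fun x => (x \in S) && (x \in f :\: t))).
        by rewrite big_mkcondr; apply: eq_bigr => x _; case: (x \in _).
      by move=> x; rewrite !inE.
    under eq_bigr do rewrite cE.
    rewrite exchange_big -sum1_card; apply: leq_sum => x xS.
    have /exists_inP[y yS fX] := H x xS.
    move: yS; rewrite in_setD1 => /andP[yx yS].
    rewrite (bigD1 (x |: (y |: t))) /=; last first.
      by rewrite inE fX; apply/imset2P; exists x y; rewrite ?in_setD1 ?yx.
    by rewrite link_trace ?link_notin // set21.
  rewrite mulnC -sum_nat_const; apply: leq_sum => f; rewrite inE => /andP[_].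
  move=> /imset2P[x y xS + ->]; rewrite in_setD1 => /andP[_ yS].
  rewrite link_trace ?link_notin //; apply: leq_trans (subset_leq_card (subsetIr _ _)) _.
  by rewrite cards2; case: (_ != _).
have : (0 < #|[set B : cplx | B \subset X :&: inner & #|B| == #|S|./2]|)%N.
  by rewrite cards_draws bin_gt0; have := half_leq c2; rewrite mul2n doubleK.
move=> /card_gt0P[B]; rewrite inE subsetI => /andP[/andP[BX Bi] cB].
by exists B; rewrite ?inE ?Bi.
Qed.
End Links.

(** * Probabilities for a uniform complex with M k-faces *)

Section UniformBounds.
Variables (R : realType) (k n : nat).
Let N := 'C(n, k.+1).
Notation cplx := {set {set 'I_n}}.
Notation pr M A := (uniform_pr R k (n := n) M A).

Lemma uniform_pr_le M (A B : pred cplx) :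
  (forall X, X \in stage k n M -> A X -> B X) -> pr M A <= pr M B.
Proof.
move=> AB; rewrite /uniform_pr ler_wpM2r ?invr_ge0 ?ler0n // ler_nat.
apply: subset_leq_card; apply/subsetP => X; rewrite inE => /andP[XM AX].
by rewrite inE XM AB.
Qed.

Lemma uniform_pr_exists M (I : finType) (P : pred I) (E : I -> pred cplx) :
  pr M (fun X => [exists i, P i && E i X]) <= \sum_(i | P i) pr M (E i).
Proof.
rewrite uniform_prE; under [leRHS]eq_bigr do rewrite uniform_prE.
rewrite exchange_big; apply: ler_sum => X _; rewrite -mulr_sumr /=.
rewrite ler_wpM2l ?divr_ge0 ?ler0n //.
case: existsP => [[i /andP[Pi Ei]]|_]; last by apply: sumr_ge0 => i _; rewrite ler0n.
by rewrite (bigD1 i) //= Ei lerDl sumr_ge0 // => j _; rewrite ler0n.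
Qed.

Lemma uniform_pr_avoid M (A : cplx) : A \subset kfaces k n ->
  pr M (fun X => [disjoint X & A]) = 'C(N - #|A|, M)%:R / 'C(N, M)%:R.
Proof.
move=> AK; rewrite /uniform_pr.
have := @card_stage_avoid k n M A finset.set0 AK (sub0set _).
rewrite cards0 !subn0 => <- //; last by rewrite -setI_eq0 setI0.
by congr (_%:R / _); apply: eq_card => X; rewrite inE [RHS]inE sub0set andbT.
Qed.

Lemma uniform_pr_avoid_contain M (A B : cplx) :
  A \subset kfaces k n -> B \subset kfaces k n -> [disjoint A & B] ->
  pr M (fun X => [disjoint X & A] && (B \subset X)) <=
  'C(N - #|A| - #|B|, M - #|B|)%:R * (#|B| <= M)%N%:R / 'C(N, M)%:R.
Proof.
move=> AK BK AB; rewrite /uniform_pr; case: (leqP #|B| M) => BM.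
  by rewrite card_stage_avoid // mulr1.
rewrite (_ : [set _ in _ | _] = finset.set0) ?cards0 ?mulr0 //.
apply/setP => X; rewrite in_set0; apply/negP.
rewrite inE => /and3P[+ _ BX]; rewrite inE => /and3P[_ _ /eqP c].
by move: BM; rewrite ltnNge -c subset_leq_card // subsetI BX.
Qed.

Lemma isolated_pair_pr M (a b : {set 'I_n}) : #|a| = k -> #|b| = k -> a != b ->
  (M <= N)%N ->
  pr M (fun X => isolated_face k X a && isolated_face k X b) <=
  'C(N - (2 * (n - k) - 1), M)%:R / 'C(N, M)%:R.
Proof.
move=> ak bk ab MN; set A := star k a :|: star k b.
have AK : A \subset kfaces k n by rewrite subUset !star_sub.
apply: le_trans (_ : pr M (fun X => [disjoint X & A]) <= _).
  apply: uniform_pr_le => X XM; rewrite !(isolated_disjoint XM) // => /andP[].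
  by rewrite -!setI_eq0 setIUr setU_eq0 => -> ->.
rewrite uniform_pr_avoid // ler_wpM2r ?invr_ge0 // ler_nat.
by rewrite leq_bin2l // leq_sub2l // card_starU.
Qed.

End UniformBounds.

(** * Bounds for the three causes of differing hitting times *)

Section ProcessBounds.
Variables (R : realType) (k n : nat).
Let N := 'C(n, k.+1).
Notation cplx := {set {set 'I_n}}.
Notation pr M A := (uniform_pr R k (n := n) M A).

Lemma link_closed_pr M (t S : {set 'I_n}) : (0 < k)%N -> #|t| = k.-1 -> S \subset ~: t ->
  (0 < N)%N -> (M <= N)%N ->
  pr M (fun X => link_closed X t S) <=
  (1 - M%:R / N%:R) ^+ (#|S| * (#|~: t| - #|S|)).
Proof.
move=> k0 tk St N0 MN; rewrite -card_cross //.
have KC := cross_sub k0 tk St.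
have aN : (#|cross t S| <= N)%N by rewrite /N -card_kfaces subset_leq_card.
apply: le_trans (bin_ratio_le R N0 aN MN); rewrite -uniform_pr_avoid //.
by apply: uniform_pr_le => X _; exact: link_closed_disjoint.
Qed.

(** Union bound over the set B of |S|/2 inner faces that covering forces to be present; all crossing
    faces are absent at the same time. *)
Lemma link_cluster_pr M (t S : {set 'I_n}) : (0 < k)%N -> #|t| = k.-1 -> S \subset ~: t ->
  (0 < #|S|)%N ->
  (#|S| * (#|~: t| - #|S|) + M <= N)%N -> (0 < N - #|S| * (#|~: t| - #|S|))%N ->
  pr M (fun X => link_closed X t S && link_covered X t S) <=
  (#|S| ^ #|S|)%:R * ((1 - M%:R / N%:R) ^+ (#|S| * (#|~: t| - #|S|)) *
    (M%:R / (N - #|S| * (#|~: t| - #|S|))%:R) ^+ #|S|./2).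
Proof.
move=> k0 tk St S0; rewrite -card_cross // => aMN Na0.
set C := cross t S; set I := inner t S.
pose P (B : cplx) := (B \subset I) && (#|B| == #|S|./2).
apply: le_trans (_ : pr M (fun X => [exists B : cplx, P B && ([disjoint X & C] && (B \subset X))]) <= _).
  apply: uniform_pr_le => X _ /andP[cl cov]; apply/existsP.
  have [B] := link_covered_inner St cov; rewrite inE => PB BX.
  by exists B; rewrite /P PB BX andbT link_closed_disjoint.
apply: le_trans (uniform_pr_exists R k M P (fun B X => [disjoint X & C] && (B \subset X))) _.
apply: (@le_trans _ _ (\sum_(B | P B) ((1 - M%:R / N%:R) ^+ #|C| *
    (M%:R / (N - #|C|)%:R) ^+ #|S|./2))).
  apply: ler_sum => B /andP[BI /eqP cB].
  have BK : B \subset kfaces k n by apply: subset_trans BI (inner_sub k0 tk St).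
  have CB : [disjoint C & B] by apply: disjointWr BI (disjoint_cross_inner St).
  apply: le_trans (uniform_pr_avoid_contain R M (cross_sub k0 tk St) BK CB) _.
  by rewrite -cB; exact: bin_both_ratio_le.
rewrite sumr_const -[leLHS]mulr_natl ler_wpM2r //.
  have aN : (#|C| <= N)%N by apply: leq_trans aMN; exact: leq_addr.
  rewrite mulr_ge0 ?exprn_ge0 ?divr_ge0 // subr_ge0 ler_pdivrMr ?mul1r ?ler_nat.
    by apply: leq_trans aMN; exact: leq_addl.
  by rewrite ltr0n; apply: leq_trans Na0 (leq_subr _ _).
(* With s = |S|, there are at most (s^2)^(s/2) <= s^s choices of B. *)
rewrite ler_nat -[X in (X <= _)%N]cardsE cards_draws.
apply: leq_trans (bin_le_exp _ _) _.
apply: leq_trans (_ : (#|S| * #|S|) ^ #|S|./2 <= _)%N.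
  by case: (#|S|./2) => // j; rewrite leq_exp2r // card_inner.
rewrite mulnn -expnM leq_pexp2l // mul2n.
by rewrite -[leqRHS]odd_double_half leq_addl.
Qed.

(** Chebyshev for the number I of isolated faces, of mean [mu]: with x the second term of the bound,
    E I^2 <= mu + mu^2 (1 + x), so P(I = 0) <= 1/mu + x. Moments are written as sums over [stage],
    that is, multiplied by c = C(N,M). *)
Lemma no_isolated_pr M : (0 < k)%N -> (M + (n - k) <= N)%N ->
  let mu : R := 'C(n, k)%:R * ('C(N - (n - k), M)%:R / 'C(N, M)%:R) in
  0 < mu -> (k < n)%N ->
  pr M (no_isolated k (n := n)) <= mu^-1 + M%:R / (N - (n - k) + 1 - M)%:R.
Proof.
move=> k0 MDN mu mu0 kn; set D := (n - k)%N in MDN mu mu0 *.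
set x := _ / _ : R.
pose c : R := 'C(N, M)%:R.
have c0 : 0 < c by rewrite ltr0n bin_gt0 (leq_trans (leq_addr _ _) MDN).
pose I (X : cplx) : R := \sum_(a : {set 'I_n} | #|a| == k) (isolated_face k X a)%:R.
have uE A : pr M A * c = \sum_(X in stage k n M) (A X)%:R.
  rewrite divfK ?gt_eqF // -sum1_card natr_sum.
  rewrite (eq_bigl (fun X => (X \in stage k n M) && A X)) => [|X]; last by rewrite inE.
  by rewrite big_mkcondr; apply: eq_bigr => X _; case: (A X).
have cardk : #|[set a : {set 'I_n} | #|a| == k]| = 'C(n, k) by rewrite card_draws card_ord.
have sum1 : \sum_(X in stage k n M) I X = mu * c.
  rewrite exchange_big /=; transitivity
    (\sum_(a in [set a : {set 'I_n} | #|a| == k]) ('C(N - D, M)%:R / c * c) : R).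
    rewrite (eq_bigl (fun a => a \in [set a : {set 'I_n} | #|a| == k])) => [|a]; last by rewrite inE.
    apply: eq_bigr => a; rewrite inE => /eqP ak; rewrite /D -(card_star ak) -uniform_pr_avoid ?star_sub //.
    by rewrite uE; apply: eq_bigr => X XM; rewrite (isolated_disjoint XM).
  by rewrite sumr_const cardk -[LHS]mulr_natl /mu -/c mulrA.
have sum2 : \sum_(X in stage k n M) I X ^+ 2 <= mu * c + mu ^+ 2 * c * (1 + x).
  have DN : (D <= N)%N by apply: leq_trans MDN; exact: leq_addl.
  have D0 : (0 < D)%N by rewrite subn_gt0.
  pose q : R := 'C(N - D, M)%:R; pose q2 : R := 'C(N - (2 * D - 1), M)%:R.
  have pair (a b : {set 'I_n}) : #|a| = k -> #|b| = k ->
      \sum_(X in stage k n M) (isolated_face k X a && isolated_face k X b)%:R <=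
      (if a == b then q else q2).
    move=> ak bk; rewrite -(uE (fun X => isolated_face k X a && isolated_face k X b)).
    have [<-|ab] := eqVneq a b.
      rewrite -[leRHS](divfK (lt0r_neq0 c0)) ler_wpM2r ?(ltW c0) // /q /D -(card_star ak).
      rewrite -uniform_pr_avoid ?star_sub //. apply: uniform_pr_le => X XM.
      by rewrite (isolated_disjoint XM ak) andbb.
    rewrite -ler_pdivlMr //; apply: isolated_pair_pr => //.
    by apply: leq_trans MDN; exact: leq_addr.
  (* The cross inequality with j = D - 1 leaves C(N-D+1,M), whose ratio to C(N-D,M) is (N-D+1) /
     (N-D+1-M) = 1 + x. *)
  have q2c : q2 * c <= q ^+ 2 * (1 + x).
    have x1 : 0 < (N - D + 1 - M)%:R :> R by rewrite ltr0n; lia.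
    rewrite (_ : 1 + x = (N - D + 1)%:R / (N - D + 1 - M)%:R); last first.
      apply: (mulIf (lt0r_neq0 x1)); rewrite divfK ?lt0r_neq0 // mulrDl mul1r /x divfK ?lt0r_neq0 //.
      by rewrite -natrD; congr _%:R; lia.
    rewrite mulrA ler_pdivlMr // -!natrM -natrX -!natrM ler_nat.
    have h1 := @bin_sub_cross_le N (N - D) M (D - 1) (leq_subr _ _) (leq_trans (leq_addr _ _) MDN).
    have h2 := mul_bin_down (N - D + 1) M.
    rewrite (_ : (N - D - (D - 1))%N = (N - (2 * D - 1))%N) in h1; last by lia.
    rewrite (_ : (N - (D - 1))%N = (N - D + 1)%N) in h1; last by lia.
    rewrite addn1 /= -addn1 in h2.
    apply: leq_trans (leq_mul h1 (leqnn _)) _.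
    by rewrite mulnAC [('C(_, _) * (_ - M))%N]mulnC -h2 -mulnA mulnn mulnC.
  pose m : R := 'C(n, k)%:R.
  apply: (@le_trans _ _ (m * (q + m * q2))).
    under eq_bigr do rewrite expr2 /I big_distrlr /=.
    rewrite exchange_big /=.
    apply: (@le_trans _ _ (\sum_(a : {set 'I_n} | #|a| == k) (q + m * q2))); last first.
      by rewrite sumr_const -cardsE cardk -[leLHS]mulr_natl lexx.
    apply: ler_sum => a /eqP ak; rewrite exchange_big /= (bigD1 a) ?ak //=; apply: lerD.
      have := pair a a ak ak; rewrite eqxx; apply: le_trans.
      by apply: ler_sum => X _; rewrite -natrM mulnb.
    apply: (@le_trans _ _ (\sum_(b : {set 'I_n} | #|b| == k) q2)).
      rewrite [leLHS]big_mkcond [leRHS]big_mkcond; apply: ler_sum => b _.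
      case: eqP => //= bk; case: eqP => [_|/eqP ab] /=; first by rewrite ler0n.
      have := pair a b ak bk; rewrite eq_sym (negPf ab); apply: le_trans.
      by apply: ler_sum => X _; rewrite -natrM mulnb.
    by rewrite sumr_const -cardsE cardk -[leLHS]mulr_natl lexx.
  rewrite /mu -/m -/q -/c mulrDr; apply: lerD; first by rewrite -mulrA divfK ?gt_eqF.
  rewrite mulrA -expr2 (_ : (m * (q / c)) ^+ 2 * c * (1 + x) = m ^+ 2 * (q ^+ 2 * (1 + x) / c)); last first.
    by field; rewrite gt_eqF.
  by rewrite ler_wpM2l ?sqr_ge0 // ler_pdivlMr.
(* Each complex with I = 0 contributes mu^2 to the sum of (I - mu)^2. *)
have sq : 0 <= \sum_(X in stage k n M) (I X - mu) ^+ 2 - mu ^+ 2 * (pr M (no_isolated k (n := n)) * c).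
  rewrite subr_ge0 uE mulr_sumr; apply: ler_sum => X XM.
  case ni: (no_isolated k X); last by rewrite mulr0 sqr_ge0.
  rewrite mulr1 /I big1 ?sub0r ?sqrrN // => a _.
  by move/forallP/(_ a): ni => /negPf ->.
have exp : \sum_(X in stage k n M) (I X - mu) ^+ 2 =
   \sum_(X in stage k n M) I X ^+ 2 - mu ^+ 2 * c.
  under eq_bigr do rewrite sqrrB.
  rewrite big_split sumrB /= sumr_const card_stage sumrMnl -mulr_suml sum1.
  by rewrite -[_ *+ 'C(_, _)]mulr_natl -/c; ring.
rewrite exp in sq.
have {sum2 sq exp} : mu ^+ 2 * c * (pr M (no_isolated k (n := n))) <= mu ^+ 2 * c * (mu^-1 + x).
  apply: le_trans (_ : mu * c + mu ^+ 2 * c * x <= _); first by lra.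
  rewrite mulrDr lerD2r [leRHS]mulrAC expr2 mulfK ?gt_eqF //.
by rewrite ler_pM2l // mulr_gt0 // exprn_gt0.
Qed.

(** Union bound over the alternatives of [hitting_times_neq]. In the last one t and the pair
    determine the added face, whence the factor 1 / (N - M). *)
Lemma Pr_neq_le M0 : (0 < k < n)%N -> (M0 < N)%N ->
  Pr R (fun Y : trajectory k n => M1 Y != M2 Y) <=
  pr M0 (no_isolated k (n := n)) +
  \sum_(t : {set 'I_n} | #|t| == k.-1)
    \sum_(S : {set 'I_n} | [&& S \subset ~: t, (1 < #|S|)%N & (2 * #|S| <= #|~: t|)%N])
      pr M0 (fun X => link_closed X t S && link_covered X t S) +
  \sum_(t : {set 'I_n} | #|t| == k.-1)
    \sum_(p : 'I_n * 'I_n | (p.1 \notin t) && (p.2 \notin p.1 |: t))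
      \sum_(M < N | (M0 <= M)%N)
        pr M (fun X => isolated_face k X (p.1 |: t) && isolated_face k X (p.2 |: t))
        / (N - M)%:R.
Proof.
move=> kn M0N.
pose E1 (Y : trajectory k n) := no_isolated k (Y (inord M0)).
pose P2 (t S : {set 'I_n}) := [&& S \subset ~: t, (1 < #|S|)%N & (2 * #|S| <= #|~: t|)%N].
pose E2 t S (Y : trajectory k n) :=
  link_closed (Y (inord M0)) t S && link_covered (Y (inord M0)) t S.
pose P3 (t : {set 'I_n}) (p : 'I_n * 'I_n) := (p.1 \notin t) && (p.2 \notin p.1 |: t).
pose iso2 (t : {set 'I_n}) (p : 'I_n * 'I_n) X :=
  isolated_face k X (p.1 |: t) && isolated_face k X (p.2 |: t).
pose E3 t p (M : 'I_N) (Y : trajectory k n) :=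
  [&& iso2 t p (Y (inord M)),
      p.2 |: (p.1 |: t) \in absent_faces k (Y (inord M)) &
      Y (inord M.+1) == (p.2 |: (p.1 |: t)) |: Y (inord M)].
pose T (t : {set 'I_n}) := #|t| == k.-1.
pose F2 Y := [exists t, T t && [exists S, P2 t S && E2 t S Y]].
pose F3 Y := [exists t, T t && [exists p, P3 t p && [exists M : 'I_N, (M0 <= M)%N && E3 t p M Y]]].
apply: (@le_trans _ _ (Pr R (fun Y => (E1 Y || F2 Y) || F3 Y))).
  apply: Pr_le => Y /trajectory_step[Y0 YS] M12.
  have [ni||] := hitting_times_neq Y0 YS kn (ltnW M0N) M12.
  - by rewrite /E1 ni.
  - move=> [t [S [tk St S1 S2 ES]]]; apply/orP; left; apply/orP; right.
    apply/existsP; exists t; rewrite /T tk eqxx; apply/existsP; exists S.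
    by rewrite /P2 St S1 S2.
  move=> [t [z [w [M [tk zw /andP[M0M MN] iso]]]]] st; apply/orP; right.
  apply/existsP; exists t; rewrite /T tk eqxx; apply/existsP; exists (z, w).
  rewrite /P3 zw; apply/existsP; exists (Ordinal MN).
  by rewrite M0M /E3 /iso2 iso.
apply: le_trans (Pr_predU R (fun Y => E1 Y || F2 Y) F3) (lerD (le_trans (Pr_predU R E1 F2) (lerD _ _)) _).
- exact: Pr_at_le.
- apply: le_trans (Pr_exists R T (fun t Y => [exists S, P2 t S && E2 t S Y])) _.
  apply: ler_sum => t _; apply: le_trans (Pr_exists R (P2 t) (E2 t)) _.
  apply: ler_sum => S _.
  exact: (Pr_at_le R (fun X => link_closed X t S && link_covered X t S)).
apply: le_trans (Pr_exists R T (fun t Y => [exists p, P3 t p && [exists M : 'I_N, (M0 <= M)%N && E3 t p M Y]])) _.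
apply: ler_sum => t _.
apply: le_trans (Pr_exists R (P3 t) (fun p Y => [exists M : 'I_N, (M0 <= M)%N && E3 t p M Y])) _.
apply: ler_sum => p _.
apply: le_trans (Pr_exists R (fun M : 'I_N => (M0 <= M)%N) (E3 t p)) _.
apply: ler_sum => M _.
exact: (Pr_step_le R (iso2 t p)).
Qed.

End ProcessBounds.

(** * Asymptotics *)

Lemma leq_third_half s : (1 < s)%N -> (s <= 3 * s./2)%N.
Proof. lia. Qed.

Lemma double_sub_pred k n : (k < n)%N -> (2 * (n - k) - 1 = (2 * (n - k.+1)).+1)%N.
Proof. lia. Qed.

Section RealAux.
Variable R : realType.

Lemma geometric_tail (x : R) N m :
  (1 - x) * (\sum_(i < N | (m <= i)%N) x ^+ i) = if (m <= N)%N then x ^+ m - x ^+ N else 0.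
Proof.
elim: N => [|N IHN].
  by rewrite big_ord0 mulr0 leqn0; case: eqP => // ->; rewrite subrr.
rewrite big_mkcond big_ord_recr -big_mkcond /= mulrDr IHN.
case: (leqP m N) => [mN|Nm]; first by rewrite leqW //= exprS; ring.
rewrite mulr0 addr0; case: (leqP m N.+1) => // mN.
by rewrite (_ : m = N.+1) ?subrr //; apply/eqP; rewrite eqn_leq mN.
Qed.

Lemma geometric_tail_le (x : R) N m : 0 <= x < 1 ->
  \sum_(i < N | (m <= i)%N) x ^+ i <= x ^+ m / (1 - x).
Proof.
move=> /andP[x0 x1]; have x1' : 0 < 1 - x by rewrite subr_gt0.
rewrite ler_pdivlMr // mulrC geometric_tail.
by case: ifP => _; rewrite ?exprn_ge0 // gerBl exprn_ge0.
Qed.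

Lemma expr1B_le (x : R) a : x <= 1 -> (1 - x) ^+ a <= expR (- (x * a%:R)).
Proof.
move=> x1; rewrite -mulNr expRM_natr; apply: lerXn2r.
- by rewrite nnegrE subr_ge0.
- by rewrite nnegrE expR_ge0.
exact: expR_ge1Dx.
Qed.

(** 1 / (1 - x) = 1 + x / (1 - x) <= expR (x / (1 - x)). *)
Lemma expr1B_ge (x : R) a : 0 <= x < 1 -> expR (- (x / (1 - x) * a%:R)) <= (1 - x) ^+ a.
Proof.
move=> /andP[x0 x1]; have x1' : 0 < 1 - x by rewrite subr_gt0.
rewrite -mulNr expRM_natr; apply: lerXn2r.
- by rewrite nnegrE expR_ge0.
- by rewrite nnegrE ltW.
rewrite expRN invf_ple ?posrE ?expR_gt0 //.
apply: le_trans (expR_ge1Dx _); rewrite le_eqVlt; apply/orP; left; apply/eqP.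
by field; rewrite gt_eqF.
Qed.

End RealAux.

(** * Explicit estimates when ln n >= 800 k *)

Section Numeric.
Variables (R : realType) (k n : nat).
Let L : R := ln n%:R.
Let kr : R := k%:R.
Let nr : R := n%:R.
Let N : nat := 'C(n, k.+1).
Let Nr : R := N%:R.
Let lam : R := kr * L / nr.
Hypotheses (k0 : (0 < k)%N) (hL : 800 * kr <= L).

Let kr1 : 1 <= kr. Proof. by rewrite ler1n. Qed.
Let L800 : 800 <= L. Proof. by move: kr1 hL; lra. Qed.

Let n0 : (0 < n)%N.
Proof.
rewrite lt0n; apply/eqP => e; move: L800.
by rewrite /L e ln0 //; lra.
Qed.

Let nr0 : 0 < nr. Proof. by rewrite ltr0n. Qed.

Let nE : expR L = nr. Proof. by rewrite lnK // posrE. Qed.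

Let n_ge : 1 + L <= nr. Proof. by rewrite -nE expR_ge1Dx. Qed.

Let n_k : 100 * (kr + 1) <= nr. Proof. by move: n_ge hL kr1; lra. Qed.

Let kn2 : (k.+1.*2 <= n)%N.
Proof. by rewrite -muln2 -(ler_nat R) natrM -(natr1 k) -/kr -/nr; move: n_k kr1; lra. Qed.

Let lamE : lam * nr = kr * L. Proof. by rewrite divfK // gt_eqF. Qed.

Let lam2 : 2 * lam <= expR (- (9/10 * L)).
Proof.
rewrite -(ler_pM2r nr0) -[2 * lam * nr]mulrA lamE -nE -expRD.
rewrite (_ : - (9 / 10 * L) + L = L / 20 + L / 20); last by field.
rewrite expRD; have h := expR_ge1Dx (L / 20).
have h2 : L / 20 <= expR (L / 20) by lra.
(* The constant 800 is needed here: (L/20)^2 >= 2 k L amounts to L >= 800 k. *)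
apply: le_trans (_ : (L / 20) * (L / 20) <= _); last first.
  by apply: ler_pM => //; move: L800; lra.
by move: hL kr1 L800; nra.
Qed.

Let lam_small : lam <= 1 / 1000.
Proof.
have := lam2; rewrite expRN; set y := expR (9 / 10 * L) => h1.
have y0 : 0 < y by exact: expR_gt0.
have h2 : 500 <= y by have := expR_ge1Dx (9 / 10 * L); rewrite -/y; move: L800; lra.
have h3 : y^-1 * y = 1 by rewrite mulVf // gt_eqF.
have h4 : 0 < y^-1 by rewrite invr_gt0.
by move: h1 h2 h3 h4; nra.
Qed.

Let lam0 : 0 < lam. Proof. by rewrite divr_gt0 // mulr_gt0 //; move: kr1 L800; lra. Qed.

Let N_ge : nr * nr / 4 <= Nr.
Proof.
have h : ('C(n, 2) <= N)%N by apply: bin_gt2_ge; [exact: k0 | exact: leqW kn2].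
have e := mul_bin_diag n 1; rewrite bin1 in e.
have e' : nr * (nr - 1) = 2 * 'C(n, 2)%:R.
  by rewrite -natrM -e natrM -subn1 natrB.
have : 'C(n, 2)%:R <= Nr by rewrite ler_nat.
by move: e' n_ge L800; nra.
Qed.

Let N0 : 0 < Nr. Proof. by apply: lt_le_trans N_ge; rewrite divr_gt0 ?mulr_gt0. Qed.

(* The expected number of isolated faces is about n^k exp(- n M / N), so the last one
   disappears around M = lam N; M0 stops at 95% of that. *)
Let M0 : nat := Num.trunc (95/100 * lam * Nr).
Let Mr : R := M0%:R.

Let M0_le : Mr <= 95/100 * lam * Nr.
Proof.
have c0 : 0 <= 95/100 * lam by move: lam0; lra.
by rewrite truncn_le; apply: mulr_ge0 => //; exact: ltW.
Qed.

Let M0_ge : 94/100 * lam * Nr <= Mr.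
Proof.
have h := truncnS_gt (95/100 * lam * Nr); rewrite -/M0 -(natr1 M0) -/Mr in h.
have h2 : 200 <= lam * Nr.
  apply: le_trans (_ : lam * (nr * nr / 4) <= _); last by rewrite ler_pM2l.
  have a1 : 800 <= lam * nr by rewrite lamE; move: kr1 L800; nra.
  by move: a1 L800 n_ge; nra.
by lra.
Qed.

Let p : R := Mr / Nr.
Let p_le : p <= 95/100 * lam. Proof. by rewrite ler_pdivrMr. Qed.
Let p_ge : 94/100 * lam <= p. Proof. by rewrite ler_pdivlMr. Qed.
Let p1 : p <= 1. Proof. by move: p_le lam_small; lra. Qed.
Let M0N : (M0 < N)%N.
Proof. by rewrite -(ltr_nat R); move: M0_le lam_small N0 lam0; rewrite -/Mr -/Nr; nra. Qed.

Let kn : (0 < k < n)%N. Proof. by rewrite k0 (leq_trans _ kn2) // -addnn leq_addr. Qed.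

Notation pr M A := (uniform_pr R k (n := n) M A).

(** There are C(n,k-1) <= n^(k-1) = exp((k-1) L) choices of t. *)
Let sum_t (F : {set 'I_n} -> R) (c : R) : 0 <= c ->
  (forall t : {set 'I_n}, #|t| = k.-1 -> F t <= c) ->
  \sum_(t : {set 'I_n} | #|t| == k.-1) F t <= expR ((kr - 1) * L) * c.
Proof.
move=> c0 Fc; apply: (@le_trans _ _ (\sum_(t : {set 'I_n} | #|t| == k.-1) c)).
  by apply: ler_sum => t /eqP; exact: Fc.
rewrite sumr_const -cardsE card_draws card_ord -[leLHS]mulr_natl ler_wpM2r //.
rewrite (_ : kr - 1 = k.-1%:R); last by rewrite -subn1 natrB.
by rewrite expRM_natl nE -natrX ler_nat bin_le_exp.
Qed.

(** Each pair costs at most (2/D) exp(-pD) <= (2/n) n^(-1.7k); with n^(k-1) choices of t and n^2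
    pairs the total is 2 n^(-0.7k). *)
Lemma merge_bound :
  \sum_(t : {set 'I_n} | #|t| == k.-1)
    \sum_(q : 'I_n * 'I_n | (q.1 \notin t) && (q.2 \notin q.1 |: t))
      \sum_(M < N | (M0 <= M)%N)
        pr M (fun X => isolated_face k X (q.1 |: t) && isolated_face k X (q.2 |: t))
        / (N - M)%:R <= 2 * expR (- (7/10 * L)).
Proof.
pose D := (2 * (n - k.+1))%N.
have DE : (D%:R : R) = 2 * (nr - kr - 1).
  by rewrite natrM natrB -?(natr1 k) ?opprD ?addrA //; case/andP: kn.
have D_ge : 19/10 * nr <= D%:R by rewrite DE; move: n_k kr1; lra.
pose u : R := D%:R / Nr; pose r := expR (- u).
have u0 : 0 < u by rewrite divr_gt0 //; move: D_ge nr0; lra.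
have u1 : u <= 1.
  rewrite ler_pdivrMr // mul1r; apply: le_trans N_ge.
  by rewrite DE; move: n_k kr1 nr0; nra.
(* For 0 < u <= 1, 1 - exp(-u) >= u/2, so the geometric series costs at most 2/u = 2N/D. *)
have r1 : u / 2 <= 1 - r.
  have h := expR_ge1Dx u; have e0 := expR_gt0 u.
  rewrite /r expRN.
  have : (expR u)^-1 <= (1 + u)^-1 by rewrite lef_pV2 ?posrE //; lra.
  have : (1 + u)^-1 <= 1 - u / 2.
    by rewrite -[leLHS]mul1r ler_pdivrMr; [nra | lra].
  by lra.
have inner_le (t : {set 'I_n}) (q : 'I_n * 'I_n) : #|t| = k.-1 -> (q.1 \notin t) && (q.2 \notin q.1 |: t) ->
  \sum_(M < N | (M0 <= M)%N)
        pr M (fun X => isolated_face k X (q.1 |: t) && isolated_face k X (q.2 |: t))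
        / (N - M)%:R <= 2 / D%:R * expR (- (p * D%:R)).
  move=> tk /andP[q1 q2].
  apply: (@le_trans _ _ (\sum_(M < N | (M0 <= M)%N) Nr^-1 * r ^+ M)).
    apply: ler_sum => M _.
    have NM : 0 < (N - M)%:R :> R by rewrite ltr0n subn_gt0.
    have MN1 : M%:R / Nr <= 1 :> R by rewrite ler_pdivrMr // mul1r ler_nat ltnW.
    rewrite ler_pdivrMr //.
    apply: le_trans (isolated_pair_pr R _ _ _ _) _.
    - by rewrite (cardU1_out tk) // prednK.
    - rewrite (cardU1_out tk) ?prednK //; by apply: contraNN q2 => h; rewrite inE h orbT.
    - apply: contraNneq q2 => ->; exact: setU11.
    - exact: ltnW.
    have -> : (2 * (n - k) - 1 = D.+1)%N by rewrite /D double_sub_pred //; case/andP: kn.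
    apply: le_trans (bin_ratio_le R _ _ _) _.
    - by rewrite -(ltr0n R).
    - rewrite -(ler_nat R) -(natr1 D) DE; apply: le_trans N_ge.
      by move: n_k kr1 nr0; nra.
    - exact: ltnW.
    (* Of the D + 1 factors 1 - M/N, one is spent to replace the 1 / (N - M) of the step by 1/N. *)
    have e : (N - M)%:R = Nr * (1 - M%:R / Nr) :> R.
      by rewrite natrB 1?ltnW // mulrBr mulr1 mulrCA divff ?gt_eqF // mulr1.
    rewrite e exprSr [Nr * _]mulrC mulrA -/Nr.
    rewrite (_ : _^-1 * _ * (1 - M%:R / Nr) * Nr = r ^+ M * (1 - M%:R / Nr)); last first.
      by field; rewrite gt_eqF.
    rewrite ler_wpM2r ?subr_ge0 //; apply: le_trans (expr1B_le _ MN1) _.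
    rewrite /r -expRM_natr (_ : M%:R / Nr * D%:R = u * M%:R) ?mulNr // /u.
    by ring.
  rewrite -mulr_sumr.
  have r01 : 0 <= r < 1 by rewrite expR_ge0 /=; move: r1 u0; lra.
  apply: le_trans (_ : Nr^-1 * (r ^+ M0 / (u / 2)) <= _).
    rewrite ler_pM2l ?invr_gt0 //; apply: le_trans (geometric_tail_le _ _ r01) _.
    rewrite ler_wpM2l ?exprn_ge0 ?expR_ge0 // lef_pV2 ?posrE; move: r1 u0; lra.
  rewrite /r -expRM_natr (_ : - u * M0%:R = - (p * D%:R)); last first.
    by rewrite /u /p mulNr -/Mr; congr (- _); ring.
  rewrite (_ : Nr^-1 * (expR (- (p * D%:R)) / (u / 2)) = 2 / D%:R * expR (- (p * D%:R))) //.
  rewrite /u; field; rewrite !gt_eqF //; move: D_ge nr0; lra.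
apply: (@le_trans _ _ (expR ((kr - 1) * L) * (nr * nr * (2 / D%:R * expR (- (p * D%:R)))))).
  have c0 : 0 <= 2 / D%:R * expR (- (p * D%:R)) :> R.
    by rewrite mulr_ge0 ?expR_ge0 // divr_ge0.
  apply: sum_t => [|t tk]; first by rewrite mulr_ge0 // mulr_ge0 // ltW.
  apply: (@le_trans _ _ (\sum_(q : 'I_n * 'I_n) 2 / D%:R * expR (- (p * D%:R)))).
    rewrite [leLHS]big_mkcond; apply: ler_sum => q _.
    by case: ifP => // h; apply: inner_le.
  rewrite sumr_const card_prod card_ord -[leLHS]mulr_natl natrM //.
apply: (@le_trans _ _ (expR ((kr - 1) * L) * (nr * nr * (2 / nr * expR (- (17/10 * kr * L)))))).
  rewrite ler_pM2l ?expR_gt0 // ler_pM2l ?mulr_gt0 //; apply: ler_pM.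
  - by rewrite divr_ge0.
  - exact: expR_ge0.
  - by rewrite ler_pM2l // lef_pV2 ?posrE //; move: D_ge nr0; lra.
  rewrite ler_expR lerN2.
  (* 0.94 * 1.9 = 1.786 exceeds the required 1.7. *)
  have h : 94/100 * lam * (19/10 * nr) <= p * D%:R.
    by apply: ler_pM => //; move: lam0 nr0; lra.
  apply: le_trans h; rewrite (_ : _ * (_ * nr) = 94/100 * (19/10) * (lam * nr)); last by ring.
  by rewrite lamE; move: kr1 L800; nra.
rewrite (_ : nr * nr * (2 / nr * _) = 2 * (nr * expR (- (17 / 10 * kr * L)))); last first.
  by field; rewrite gt_eqF.
rewrite -nE mulrCA ler_pM2l // -!expRD ler_expR.
by move: kr1 L800; nra.
Qed.

(** The mean is at least (n/k)^k n^(-0.96k) >= n^0.03 / k^k, and the correlation term is at most 2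
    lam <= n^(-0.9). *)
Lemma isolated_bound :
  pr M0 (no_isolated k (n := n)) <= kr ^+ k * expR (- (3/100 * L)) + expR (- (9/10 * L)).
Proof.
pose D := (n - k)%N.
have DE : D%:R = nr - kr :> R by rewrite natrB // ltnW //; case/andP: kn.
have D0 : 0 <= D%:R :> R by [].
have Dn : D%:R <= nr by rewrite DE; move: kr1; lra.
have nN : nr <= 5/1000 * Nr by move: N_ge n_ge L800; nra.
have M0_small : Mr <= Nr / 1000.
  apply: le_trans M0_le _; rewrite [leRHS]mulrC ler_pM2r //; move: lam_small lam0; lra.
have MDN : (M0 + D <= N)%N.
  by rewrite -(ler_nat R) natrD -/Mr -/Nr; move: N0; lra.
have DN : (D <= N)%N by apply: leq_trans MDN; exact: leq_addl.
have NDE : (N - D)%:R = Nr - D%:R :> R by rewrite natrB.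
have ND0 : (0 < N - D)%N by rewrite -(ltr0n R) NDE; move: N0; lra.
pose mu : R := 'C(n, k)%:R * ('C(N - D, M0)%:R / 'C(N, M0)%:R).
have ratio : expR (- (96/100 * (kr * L))) <= 'C(N - D, M0)%:R / 'C(N, M0)%:R.
  apply: le_trans (bin_ratio_ge R ND0 MDN); rewrite NDE -/Mr.
  set y := Mr / _.
  (* D is at most N/200 and 0.95 / 0.995 < 0.955; the later passage to 0.96 absorbs the factor 1 /
     (1 - y). *)
  have yle : y <= 955/1000 * lam.
    rewrite ler_pdivrMr; last by move: N0; lra.
    by apply: le_trans M0_le _; move: lam0 N0; nra.
  have y0 : 0 <= y by rewrite divr_ge0 // -NDE.
  have y01 : 0 <= y < 1 by rewrite y0 /=; move: lam_small; lra.
  apply: le_trans (expr1B_ge _ y01); rewrite ler_expR lerN2.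
  rewrite -lamE mulrA; apply: ler_pM => //.
    by rewrite divr_ge0 // subr_ge0; move: y01; lra.
  rewrite ler_pdivrMr; last by move: lam_small; lra.
  by move: lam_small lam0; nra.
have kk : 0 < kr ^+ k by rewrite exprn_gt0 //; move: kr1; lra.
have binge : expR (kr * L) / kr ^+ k <= 'C(n, k)%:R.
  rewrite ler_pdivrMr // expRM_natl nE mulrC -!natrX -natrM ler_nat.
  by apply: exp_le_bin; case/andP: kn => _ /ltnW.
have muge : expR (3/100 * L) / kr ^+ k <= mu.
  apply: le_trans (_ : (expR (kr * L) / kr ^+ k) * expR (- (96/100 * (kr * L))) <= _); last first.
    by apply: ler_pM => //; rewrite ?divr_ge0 ?expR_ge0 // ltW.
  rewrite [expR (kr * L) / _ * _]mulrAC -expRD ler_pM2r ?invr_gt0 // ler_expR; move: kr1 L800; nra.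
have mu0 : 0 < mu by apply: lt_le_trans muge; rewrite divr_gt0 ?expR_gt0.
have := no_isolated_pr k0 MDN mu0.
case/andP: kn => _ kn' /(_ kn') /le_trans; apply; apply: lerD.
  rewrite -/mu expRN -invf_div lef_pV2 ?posrE //.
  by rewrite divr_gt0 ?expR_gt0.
have e : (N - D + 1 - M0)%:R = Nr - D%:R + 1 - Mr.
  by rewrite natrB ?natrD ?NDE // -(ler_nat R) natrD NDE -/Mr; move: N0; lra.
apply: le_trans lam2; rewrite e -/Mr ler_pdivrMr; last by move: N0; lra.
by move: M0_le lam0 N0; nra.
Qed.

(** Sets of size s <= n/20 contribute at most x^s in total for each s. For larger sets closedness
    alone suffices: its probability exp(-0.02 n L) beats the 2^n choices of S. *)
Lemma cluster_bound :
  \sum_(t : {set 'I_n} | #|t| == k.-1)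
    \sum_(S : {set 'I_n} | [&& S \subset ~: t, (1 < #|S|)%N & (2 * #|S| <= #|~: t|)%N])
      pr M0 (fun X => link_closed X t S && link_covered X t S) <=
  2 * expR (- (2/10 * L)) + expR (- L).
Proof.
(* x = e^2 n h, where h = n^(-0.88k - 0.3) is the cost per point of S found below, and e^2 dominates
   the 4 of [bin_mul_exp_le]. *)
pose x := expR (2 + 7/10 * L - 88/100 * kr * L).
have xhalf : x <= 1/2.
  have h : x <= expR (- 1) by rewrite ler_expR; move: kr1 L800; nra.
  have h1 := expR_ge1Dx (1 : R).
  have : expR (- 1) <= 2^-1 :> R by rewrite expRN lef_pV2 ?posrE ?expR_gt0.
  by lra.
have four : 4 <= expR 2 :> R.
  have h1 := expR_ge1Dx (1 : R).
  rewrite (_ : 2 = 1 + 1 :> R); last by [].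
  by rewrite expRD; nra.
have vE (t : {set 'I_n}) : #|t| = k.-1 -> #|~: t|%:R = nr - kr + 1 :> R.
  move=> tk; have := cardsC t; rewrite tk card_ord => e.
  have : k.-1%:R + #|~: t|%:R = nr by rewrite -natrD e.
  by rewrite -subn1 natrB // -/kr => <-; ring.
have aE (t S : {set 'I_n}) : #|t| = k.-1 -> S \subset ~: t ->
    (#|S| * (#|~: t| - #|S|))%:R = #|S|%:R * (nr - kr + 1 - #|S|%:R) :> R.
  by move=> tk St; rewrite natrM natrB ?vE // subset_leq_card.
have small (t S : {set 'I_n}) : #|t| = k.-1 -> S \subset ~: t -> (1 < #|S|)%N -> (20 * #|S| <= n)%N ->
    pr M0 (fun X => link_closed X t S && link_covered X t S) <=
    (#|S| ^ #|S|)%:R * expR (- (88/100 * kr * L + 3/10 * L)) ^+ #|S|.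
  move=> tk St S1 S20; set s := #|S|; pose sr : R := s%:R.
  have sr2 : 2 <= sr by rewrite ler_nat.
  have sr20 : 20 * sr <= nr by rewrite -natrM ler_nat.
  pose a := (s * (#|~: t| - s))%N.
  have aR : a%:R = sr * (nr - kr + 1 - sr) :> R by exact: aE.
  (* a <= (n/20) n, while N >= n^2/4. *)
  have a_le : a%:R <= Nr / 5 by rewrite aR; move: N_ge kr1; nra.
  have M0_small : Mr <= Nr / 1000.
    by apply: le_trans M0_le _; move: lam_small lam0 N0; nra.
  have aMN : (a + M0 <= N)%N by rewrite -(ler_nat R) natrD -/Mr -/Nr; move: N0; lra.
  have NaE : (N - a)%:R = Nr - a%:R :> R.
    by rewrite natrB //; apply: leq_trans aMN; exact: leq_addr.
  have Na0 : (0 < N - a)%N by rewrite -(ltr0n R) NaE; move: N0; lra.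
  apply: le_trans (link_cluster_pr R k0 tk St (ltnW S1) aMN Na0) _.
  rewrite ler_wpM2l // -/s -/a -/Mr -/Nr -/p.
  rewrite opprD expRD [leRHS]exprMn; apply: ler_pM.
  - by rewrite exprn_ge0 // subr_ge0.
  - by rewrite exprn_ge0 // divr_ge0.
  - apply: le_trans (expr1B_le _ p1) _; rewrite -expRM_natr ler_expR mulNr lerN2 -/sr.
    (* At least 0.94 n points lie outside S and t, and 0.94^2 > 0.88. *)
    have h : 94/100 * lam * (sr * (94/100 * nr)) <= p * a%:R.
      apply: ler_pM => //; first by move: lam0; lra.
        by apply: mulr_ge0 => //; move: nr0; lra.
      by rewrite aR ler_wpM2l //; move: n_k kr1 sr20; lra.
    apply: le_trans h.
    rewrite (_ : _ * _ * (sr * _) = 94/100 * (94/100) * (lam * nr) * sr); last by ring.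
    have w0 : 0 <= kr * L * sr by apply: mulr_ge0 => //; rewrite -lamE mulr_ge0 // ltW.
    by rewrite lamE; move: w0; lra.
  have q : Mr / (N - a)%:R <= expR (- (9/10 * L)).
    apply: le_trans lam2; rewrite NaE ler_pdivrMr; last by move: N0; lra.
    by move: M0_le lam0 N0; nra.
  apply: (@le_trans _ _ (expR (- (9/10 * L)) ^+ s./2)).
    by apply: lerXn2r => //; rewrite nnegrE ?expR_ge0 // divr_ge0.
  rewrite -!expRM_natr ler_expR !mulNr lerN2 -/sr.
  (* Rounding s/2 down keeps at least s/3, so n^(-0.9) to that power is at most n^(-0.3 s). *)
  have h : sr <= 3 * s./2%:R by rewrite -natrM ler_nat; exact: leq_third_half.
  by move: L800; nra.
have large (t S : {set 'I_n}) : #|t| = k.-1 -> S \subset ~: t -> (2 * #|S| <= #|~: t|)%N ->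
    ~~ (20 * #|S| <= n)%N ->
    pr M0 (fun X => link_closed X t S && link_covered X t S) <= expR (- (2/100 * L * nr)).
  move=> tk St S2 S20; set s := #|S|; pose sr : R := s%:R.
  have sr20 : nr <= 20 * sr by rewrite -natrM ler_nat ltnW // ltnNge.
  have sr2 : 2 * sr <= nr - kr + 1 by rewrite -(vE t tk) -natrM ler_nat.
  apply: le_trans (uniform_pr_le (B := fun X => link_closed X t S) _ _) _.
    by move=> X _ /andP[].
  apply: le_trans (link_closed_pr R k0 tk St _ (ltnW M0N)) _; first by apply: leq_ltn_trans M0N.
  apply: le_trans (expr1B_le _ p1) _; rewrite ler_expR lerN2 aE // -/s -/sr.
  (* Now s >= n/20, at least 0.45 n points lie outside S and t, and 0.94 * 0.45 / 20 > 0.02. *)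
  have h : 94/100 * lam * (nr / 20 * (45/100 * nr)) <= p * (sr * (nr - kr + 1 - sr)).
    apply: ler_pM => //; first by move: lam0; lra.
      by move: nr0; nra.
    by apply: ler_pM; move: nr0 n_k kr1; lra.
  apply: le_trans h.
  rewrite (_ : _ * _ * (_ / 20 * _) = 94/100 * (45/100) / 20 * (lam * nr) * nr); last by field.
  have w1 : 0 <= L * nr by apply: mulr_ge0 => //; move: L800; lra.
  have w2 : 0 <= (kr - 1) * (L * nr) by apply: mulr_ge0 => //; move: kr1; lra.
  by rewrite lamE; move: w1 w2; lra.
have x01 : 0 <= x < 1 by rewrite expR_ge0 /=; move: xhalf; lra.
pose h := expR (- (88/100 * kr * L + 3/10 * L)).
have by_card : \sum_(S : {set 'I_n} | (1 < #|S|)%N) (#|S| ^ #|S|)%:R * h ^+ #|S| <= 2 * x ^+ 2.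
  apply: (@le_trans _ _ (\sum_(j < n.+1 | (1 < j)%N) x ^+ j)); last first.
    apply: le_trans (geometric_tail_le _ _ x01) _; rewrite mulrC ler_wpM2r ?sqr_ge0 //.
    by rewrite -[leRHS]invrK lef_pV2 ?posrE; move: xhalf; lra.
  have cardS (S : {set 'I_n}) : (#|S| < n.+1)%N by rewrite ltnS -[leqRHS](card_ord n) max_card.
  rewrite (partition_big (fun S : {set 'I_n} => Ordinal (cardS S)) (fun j : 'I_n.+1 => (1 < j)%N)) //=.
  apply: ler_sum => j j1.
  apply: (@le_trans _ _ (\sum_(S in [set S : {set 'I_n} | #|S| == j]) (j ^ j)%:R * h ^+ j)).
    rewrite [leLHS]big_mkcond [leRHS]big_mkcond; apply: ler_sum => S _.
    rewrite inE -val_eqE /=; case: eqP => [->|_]; first by rewrite j1.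
    by rewrite andbF.
  rewrite sumr_const card_draws card_ord -[leLHS]mulr_natl mulrA -natrM.
  apply: le_trans (_ : ((4 * n) ^ j)%:R * h ^+ j <= _).
    by rewrite ler_wpM2r ?exprn_ge0 ?expR_ge0 // ler_nat bin_mul_exp_le.
  rewrite natrX -exprMn; apply: lerXn2r; rewrite ?nnegrE ?mulr_ge0 ?expR_ge0 //.
  apply: (@le_trans _ _ (expR 2 * expR L * h)).
    by rewrite ler_wpM2r ?expR_ge0 // natrM nE ler_wpM2r // ltW.
  by rewrite -!expRD ler_expR; lra.
pose e := expR (nr - 2/100 * L * nr).
have per_t (t : {set 'I_n}) : #|t| = k.-1 ->
  \sum_(S : {set 'I_n} | [&& S \subset ~: t, (1 < #|S|)%N & (2 * #|S| <= #|~: t|)%N])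
      pr M0 (fun X => link_closed X t S && link_covered X t S) <= 2 * x ^+ 2 + e.
  move=> tk; rewrite (bigID (fun S : {set 'I_n} => (20 * #|S| <= n)%N)) /=; apply: lerD.
    apply: le_trans by_card; rewrite [leLHS]big_mkcond [leRHS]big_mkcond.
    apply: ler_sum => S _; case: ifP => [/andP[/and3P[St S1 S2] S20]|_].
      by rewrite S1; apply: small.
    by case: ifP => _ //; rewrite mulr_ge0 ?exprn_ge0 ?expR_ge0.
  apply: (@le_trans _ _ (\sum_(S : {set 'I_n}) expR (- (2/100 * L * nr)))).
    rewrite [leLHS]big_mkcond; apply: ler_sum => S _.
    case: ifP => [/andP[/and3P[St S1 S2] S20]|_]; last exact: expR_ge0.
    exact: large.
  rewrite sumr_const -cardsT -powersetT card_powerset cardsT card_ord -[leLHS]mulr_natl.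
  rewrite /e expRD ler_pM2r ?expR_gt0 // natrX -[nr]mul1r expRM_natr.
  apply: lerXn2r; rewrite ?nnegrE ?expR_ge0 //.
  by have := expR_ge1Dx (1 : R); lra.
apply: le_trans (sum_t _ per_t) _.
  by rewrite addr_ge0 ?expR_ge0 // mulr_ge0 // sqr_ge0.
rewrite mulrDr; apply: lerD.
  (* n^(k-1) x^2 = e^4 n^(0.4 - 0.76k), at most n^(-0.2) as k >= 1. *)
  rewrite mulrCA ler_pM2l // expr2 -!expRD ler_expR.
  by move: kr1 L800; nra.
rewrite -expRD ler_expR.
(* Half of the exponent 0.02 n L absorbs n^k, since k <= n/100; the other half absorbs e^n. *)
have h1 : kr * L <= nr / 100 * L by rewrite ler_pM2r; move: n_k L800; lra.
have h2 : nr * 8 <= nr / 100 * L by move: nr0 L800; nra.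
by rewrite mulrBl mul1r; move: nr0; nra.
Qed.

(** The slowest decay is n^(-0.03), from the isolated faces; 6 = 1 + (2 + 1) + 2 collects the
    constant coefficients of the three bounds. *)
Lemma Pr_neq_bound :
  Pr R (fun Y : trajectory k n => M1 Y != M2 Y) <= (kr ^+ k + 6) * expR (- (3/100 * L)).
Proof.
apply: le_trans (Pr_neq_le R kn M0N) _.
apply: le_trans (lerD (lerD isolated_bound cluster_bound) merge_bound) _.
have small c : 3/100 <= c -> expR (- (c * L)) <= expR (- (3/100 * L)).
  by move=> hc; rewrite ler_expR lerN2 ler_pM2r //; move: L800; lra.
have := small (9/10) ltac:(lra); have := small (2/10) ltac:(lra).
have := small (7/10) ltac:(lra); have := small 1 ltac:(lra); rewrite mul1r.
by rewrite mulrDl; lra.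
Qed.

End Numeric.

(** * Passage to the limit *)

Local Open Scope classical_set_scope.

Theorem theorem1p9 (R : realType) (k : nat) (hk : (1 <= k)%N) :
  (fun n : nat => Pr R (fun Y : trajectory k n => M1 Y == M2 Y)) @ \oo --> (1 : R).
Proof.
pose C : R := k%:R ^+ k + 6.
have lnoo : (fun n : nat => 3/100 * ln n%:R : R) @ \oo --> +oo.
  apply/cvgryPge => A.
  near=> n.
  have : expR (`|A| * 100 / 3) <= n%:R.
    by near: n; exact: nbhs_infty_ger.
  move=> h; have n0 : 0 < n%:R :> R by apply: lt_le_trans h; exact: expR_gt0.
  rewrite -ler_ln ?posrE ?expR_gt0 // expRK in h.
  by have := ler_norm A; lra.
have lim0 : (fun n : nat => 1 - C * expR (- (3/100 * ln n%:R)) : R) @ \oo --> (1 : R).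
  rewrite -[X in _ --> X]subr0 -[X in _ --> _ - X](mulr0 C).
  apply: cvgB; first exact: cvg_cst.
  apply: cvgM; first exact: cvg_cst.
  exact: (cvg_comp (fun n : nat => 3/100 * ln n%:R : R) (fun x : R => expR (- x)) lnoo (@cvgr_expR R)).
(* The probability is squeezed between 1 - C n^(-0.03) and 1 once ln n >= 800 k. *)
apply: (squeeze_cvgr _ lim0 (cvg_cst _)).
near=> n.
have hn : 800 * k%:R <= ln n%:R :> R.
  have : expR (800 * k%:R) <= n%:R :> R by near: n; exact: nbhs_infty_ger.
  move=> h; have n0 : 0 < n%:R :> R by apply: lt_le_trans h; exact: expR_gt0.
  by rewrite -ler_ln ?posrE ?expR_gt0 // expRK in h.
have neq := Pr_neq_bound hk hn.
have neq0 : 0 <= Pr R (fun Y : trajectory k n => M1 Y != M2 Y).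
  by apply: sumr_ge0 => Y _; exact: trajectory_pr_ge0.
rewrite PrC; apply/andP; split; last by lra.
by rewrite lerB.
Unshelve. all: by end_near.
Qed.
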